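(* Let $V$ be a vertex operator algebra over $\mathbb{C}$ and let $W_1,W_2,W_3$ be three $V$-modules with decompositions $W_i=\bigoplus_{j=0}^{\infty}(W_i)_{\lambda_i+j}$, where $\lambda_i\in\mathbb{C}$ and $(W_i)_{\lambda_i+j}$ is the eigenspace of $L(0)$ with eigenvalue $\lambda_i+j$; regard $W_i$ as an $\mathbb{N}$-graded weak $V$-module by $W_i(j)=(W_i)_{\lambda_i+j}$. For an intertwining operator $I(\ ,x)$ of type $\binom{W_3}{W_1\ W_2}$ put $I^{o}(\ ,x)=x^{\lambda_1+\lambda_2-\lambda_3}I(\ ,x)$. Then the map $$I\binom{W_3}{W_1\ W_2}\rightarrow I_{\mathbb{Z}}\binom{W_3}{W_1\ W_2},\qquad I(\ ,x)\mapsto I^{o}(\ ,x),$$ from the space of intertwining operators to the space of $\mathbb{Z}$-graded intertwining operators of type $\binom{W_3}{W_1\ W_2}$, is a linear isomorphism.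
   Context: $\mathbb{N}$ is the set of non-negative integers; $x,y,x_0,x_1,x_2$ are commuting formal variables. $(V,Y,\mathbf{1},\omega)$ is a vertex operator algebra over $\mathbb{C}$, graded by weights; on a weak $V$-module $M$ write $Y_M(\omega,x)=\sum_{i\in\mathbb{Z}}L(i)x^{-i-2}$ and $Y_M(a,x)=\sum_i a_ix^{-i-1}$. For a vector space $M$, $M\{x\}=\{\sum_{\alpha\in\mathbb{C}}u_\alpha x^\alpha\mid u_\alpha\in M\}$ and $M((x))$ is the space of formal Laurent series with finitely many negative powers. Intertwining operators. For $V$-modules $W_1,W_2,W_3$, an intertwining operator of type $\binom{W_3}{W_1\ W_2}$ is a linear map $I(\ ,x):W_1\otimes_{\mathbb{C}}W_2\to W_3\{x\}$, $I(u,x)v=\sum_{\alpha\in\mathbb{C}}u_\alpha v\,x^{-\alpha-1}$ with $u_\alpha\in\operatorname{Hom}_{\mathbb{C}}(W_2,W_3)$, such that: (1) for $u\in W_1,v\in W_2,\alpha\in\mathbb{C}$, $u_{\alpha+m}v=0$ for sufficiently large $m\in\mathbb{N}$; (2) for $u\in W_1$, $a\in V$, $x_0^{-1}\delta(\frac{x_1-x_2}{x_0})Y(a,x_1)I(u,x_2)-x_0^{-1}\delta(\frac{x_2-x_1}{-x_0})I(u,x_2)Y(a,x_1)=x_1^{-1}\delta(\frac{x_2+x_0}{x_1})I(Y(a,x_0)u,x_2)$; (3) $I(L(-1)u,x)=\frac{d}{dx}I(u,x)$ for $u\in W_1$. The space of these is $I\binom{W_3}{W_1\ W_2}$. $\mathbb{N}$-graded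 weak modules. A weak $V$-module $M$ is $\mathbb{N}$-graded if $M=\bigoplus_{j=0}^{\infty}M(j)$ with $a_kM(j)\subset M(\mathrm{wt}\,a+j-k-1)$ for homogeneous $a\in V$, $j\in\mathbb{N}$, $k\in\mathbb{Z}$ (with $M(j)=0$ for $j<0$). $\mathbb{Z}$-graded intertwining operators. For a vector space $M$, define linear injective maps on $M[[x,y]][x^{-1},y^{-1},(x-y)^{-1}]$, namely $\iota_{x,y}$ into $M((x))((y))$, $\iota_{y,x}$ into $M((y))((x))$, $\iota_{x,y-x}$ into $M((x))((y-x))$, determined by $\iota_{x,y}(x^jy^k(x-y)^l)=\sum_{i\ge0}\binom{l}{i}(-1)^ix^{j+l-i}y^{k+i}$, $\iota_{y,x}(x^jy^k(x-y)^l)=\sum_{i\ge0}\binom{l}{i}(-1)^{l-i}y^{k+l-i}x^{j+i}$, $\iota_{x,y-x}(x^jy^k(x-y)^l)=\sum_{i\ge0}\binom{k}{i}x^{j+k-i}(-1)^l(y-x)^{l+i}$ for $j,k,l\in\mathbb{Z}$, and being the identity on $M$. For $\mathbb{N}$-graded weak $V$-modules $W_1,W_2,W_3$, a $\mathbb{Z}$-graded intertwining operator of type $\binom{W_3}{W_1\ W_2}$ is a linear map $\Phi(\ ,x)=\sum_{n\in\mathbb{Z}}\Phi(\ ;n)x^{-n-1}:W_1\otimes_{\mathbb{C}}W_2\to W_3((x))$ such that: (1) $\Phi(u;k)W_2(j)\subset W_3(i+j-k-1)$ for $i,j\in\mathbb{N}$, $k\in\mathbb{Z}$, $u\in W_1(i)$;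 (2) for $u\in W_1$, $v\in W_2$, $a\in V$ there exists $\Phi(a,u,v|x,y)\in W_3[[x,y]][x^{-1},y^{-1},(x-y)^{-1}]$ such that $\iota_{x,y}\Phi(a,u,v|x,y)=\Phi(u,x)Y_{W_2}(a,y)v$, $\iota_{y,x}\Phi(a,u,v|x,y)=Y_{W_3}(a,y)\Phi(u,x)v$ and $\iota_{x,y-x}\Phi(a,u,v|x,y)=\Phi(Y_{W_1}(a,y-x)u,x)v$. The space of these is $I_{\mathbb{Z}}\binom{W_3}{W_1\ W_2}$. *)

(* Defs.v *)
From HB Require Import structures.
From mathcomp Require Import all_boot all_order all_algebra.
From mathcomp Require Import complex ring.
From mathcomp Require Import boolp classical_sets functions cardinality fsbigop.
From mathcomp Require Import reals.

Set Implicit Arguments.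
Unset Strict Implicit.
Unset Printing Implicit Defensive.

Import Order.TTheory GRing.Theory Num.Theory.
Local Open Scope classical_set_scope.
Local Open Scope ring_scope.

Section LinearAlgebra.
Variable K : numFieldType.

Definition subspace (M : lmodType K) (A : set M) : Prop :=
  A 0 /\ forall (c : K) (u v : M), A u -> A v -> A (c *: u + v).

Definition finite_dim (M : lmodType K) (A : set M) : Prop :=
  exists (n : nat) (b : 'I_n -> M), (forall i, A (b i)) /\
    forall v, A v -> exists c : 'I_n -> K, v = \sum_i c i *: b i.

Definition direct_sum (M : lmodType K) (J : choiceType) (F : J -> set M) : Prop :=
  (forall j, subspace (F j)) /\
  forall v : M, exists! f : J -> M,
    [/\ finite_set [set j | f j <> 0], forall j, F j (f j)
      & v = \sum_(j \in [set: J]) f j].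

Definition eigenspace_of (M : lmodType K) (L : M -> M) (mu : K) : set M :=
  [set w | L w = mu *: w].

Definition bilinear_map (M N P : lmodType K) (f : M -> N -> P) : Prop :=
  (forall u, linear (f u)) /\ (forall v, linear (f^~ v)).

Definition linear_isomorphism (M N : lmodType K) (A : set M) (B : set N)
    (f : M -> N) : Prop :=
  [/\ subspace A, subspace B,
      forall (c : K) (u v : M), A u -> A v -> f (c *: u + v) = c *: f u + f v
    & set_bij A B f].

End LinearAlgebra.

(* A formal series with coefficients in M is the function sending an exponent
   to its coefficient.  All exponents live in K (the complex numbers in the
   end), so that M{x} is K -> M, and M((x)) and M[[x]] are subspaces of it;
   series in several variables have exponents in K * K or K * K * K. *)
Section FormalSeries.
Variable K : numFieldType.

(* (n choose i) = n (n-1) ... (n-i+1) / i!, for an integer n of any sign *)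
Definition binz (n : int) (i : nat) : K :=
  (\prod_(j < i) (n%:~R - j%:R)) / (i`!)%:R.

(* \sum_i c_i x^(d_i), for families in which each exponent occurs only
   finitely often *)
Definition monomial_sum (E : Type) (J : choiceType) (c : J -> K) (d : J -> E) :
    E -> K :=
  fun e => \sum_(j \in [set j | d j = e]) c j.

(* Product of a scalar series and a vector series, for which each coefficient
   must be a finite sum (\sum_(_ \in _) is 0 on a family of infinite
   support). *)
Definition series_mul (E : zmodType) (M : lmodType K) (f : E -> K)
    (g : E -> M) : E -> M :=
  fun e => \sum_(d \in [set: E]) f d *: g (e - d).

Section OneVariable.
Variable M : lmodType K.

Definition laurent : set (K -> M) :=
  [set f | exists N : int, forall alpha : K, f alpha <> 0 ->
     exists2 n : int, N <= n & alpha = n%:~R].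

Definition constant_series (v : M) : K -> M :=
  fun alpha => if alpha == 0 then v else 0.

Definition derivative (f : K -> M) : K -> M :=
  fun alpha => (alpha + 1) *: f (alpha + 1).

(* x^mu f(x) *)
Definition xpow_mul (mu : K) (f : K -> M) : K -> M :=
  fun alpha => f (alpha - mu).

End OneVariable.

(* Exponents are those of (x_0, x_1, x_2); as usual a binomial is expanded in
   nonnegative powers of its second term and delta(x) = \sum_n x^n. *)

(* x_0^-1 delta((x_1 - x_2) / x_0) = \sum_n x_0^(-n-1) (x_1 - x_2)^n *)
Definition delta_x1_sub_x2 : K * K * K -> K :=
  monomial_sum (fun p : int * nat => let '(n, i) := p in
                  binz n i * (-1) ^+ i)
               (fun p => let '(n, i) := p in
                  (- n%:~R - 1, n%:~R - i%:R, i%:R)).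

(* x_0^-1 delta((x_2 - x_1) / - x_0)
   = \sum_n (-1)^n x_0^(-n-1) (x_2 - x_1)^n *)
Definition delta_x2_sub_x1 : K * K * K -> K :=
  monomial_sum (fun p : int * nat => let '(n, i) := p in
                  (-1) ^ n * (binz n i * (-1) ^+ i))
               (fun p => let '(n, i) := p in
                  (- n%:~R - 1, i%:R, n%:~R - i%:R)).

(* x_1^-1 delta((x_2 + x_0) / x_1) = \sum_n x_1^(-n-1) (x_2 + x_0)^n *)
Definition delta_x2_add_x0 : K * K * K -> K :=
  monomial_sum (fun p : int * nat => let '(n, i) := p in binz n i)
               (fun p => let '(n, i) := p in
                  (i%:R, - n%:~R - 1, n%:~R - i%:R)).

(* The Jacobi identity for a formal series I(u, x) v, with Y1, Y2 and Y3 the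
   vertex operators on the three spaces. *)
Definition jacobi_identity (V W1 W2 W3 : lmodType K)
    (Y1 : V -> W1 -> K -> W1) (Y2 : V -> W2 -> K -> W2)
    (Y3 : V -> W3 -> K -> W3) (I : W1 -> W2 -> K -> W3) : Prop :=
  forall (a : V) (u : W1) (v : W2) (e : K * K * K),
    (* Y(a, x_1) I(u, x_2) v *)
    let YI := fun e : K * K * K => let '(e0, e1, e2) := e in
      if e0 == 0 then Y3 a (I u v e2) e1 else 0 in
    (* I(u, x_2) Y(a, x_1) v *)
    let IY := fun e : K * K * K => let '(e0, e1, e2) := e in
      if e0 == 0 then I u (Y2 a v e1) e2 else 0 in
    (* I(Y(a, x_0) u, x_2) v *)
    let IYu := fun e : K * K * K => let '(e0, e1, e2) := e in
      if e1 == 0 then I (Y1 a u e0) v e2 else 0 in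
    series_mul delta_x1_sub_x2 YI e - series_mul delta_x2_sub_x1 IY e
      = series_mul delta_x2_add_x0 IYu e.

(* a_n w, where Y(a, x) w = \sum_n a_n w x^(-n-1) *)
Definition mode (V W : lmodType K) (Y : V -> W -> K -> W) (a : V) (n : int)
    (w : W) : W :=
  Y a w (- n%:~R - 1).

(* L(n), where Y(omega, x) = \sum_n L(n) x^(-n-2), i.e. omega_(n+1) *)
Definition Lmode (V W : lmodType K) (Y : V -> W -> K -> W) (omega : V)
    (n : int) (w : W) : W :=
  mode Y omega (n + 1) w.

End FormalSeries.

Section VertexOperatorAlgebra.
Variable K : numFieldType.

Record voa := Voa {
  voa_sort :> lmodType K;
  voaY : voa_sort -> voa_sort -> K -> voa_sort;
  vacuum : voa_sort;
  omega : voa_sort;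
  central_charge : K;
  voaY_bilinear : bilinear_map voaY;
  voaY_laurent : forall a b, laurent (voaY a b);
  voaY_vacuum : forall b, voaY vacuum b = constant_series b;
  voaY_creation : forall a,
    (forall alpha, voaY a vacuum alpha <> 0 -> exists n : nat, alpha = n%:R) /\
    voaY a vacuum 0 = a;
  voaY_jacobi : jacobi_identity voaY voaY voaY voaY;
  voa_virasoro : forall (m n : int) (b : voa_sort),
    Lmode voaY omega m (Lmode voaY omega n b)
      - Lmode voaY omega n (Lmode voaY omega m b)
    = (m - n)%:~R *: Lmode voaY omega (m + n) b
      + (if m + n == 0
         then ((m ^+ 3 - m)%:~R / 12%:R * central_charge) *: b else 0);
  voa_L_1 : forall a b,
    voaY (Lmode voaY omega (-1) a) b = derivative (voaY a b);
  voa_grading :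
    direct_sum (fun n : int => eigenspace_of (Lmode voaY omega 0) n%:~R);
  voa_finite_dim : forall n : int,
    finite_dim (eigenspace_of (Lmode voaY omega 0) n%:~R);
  voa_lower_bound : exists N : int, forall n : int, n < N ->
    eigenspace_of (Lmode voaY omega 0) n%:~R = [set 0];
  voa_vacuum_weight : eigenspace_of (Lmode voaY omega 0) 0 vacuum;
  voa_omega_weight : eigenspace_of (Lmode voaY omega 0) 2%:R omega
}.

Definition weight_space (V : voa) (n : int) : set V :=
  eigenspace_of (Lmode (@voaY V) (omega V) 0) n%:~R.

Variable V : voa.

Record weak_module := WeakModule {
  wm_sort :> lmodType K;
  modY : V -> wm_sort -> K -> wm_sort;
  modY_bilinear : bilinear_map modY;
  modY_laurent : forall a w, laurent (modY a w);
  modY_vacuum : forall w, modY (vacuum V) w = constant_series w;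
  modY_jacobi : jacobi_identity (@voaY V) modY modY modY
}.

(* M_lambda, the eigenspace of L(0) *)
Definition L0_eigenspace (M : weak_module) (lambda : K) : set M :=
  eigenspace_of (Lmode (@modY M) (omega V) 0) lambda.

Record voa_module := VoaModule {
  vm_weak :> weak_module;
  vm_grading : direct_sum (fun lambda : K => @L0_eigenspace vm_weak lambda);
  vm_finite_dim : forall lambda : K, finite_dim (@L0_eigenspace vm_weak lambda);
  vm_lower_bound : forall lambda : K, exists N : nat, forall n : nat,
    (N <= n)%N -> @L0_eigenspace vm_weak (lambda - n%:R) = [set 0]
}.

Definition extend_grading (M : lmodType K) (F : nat -> set M) (j : int) :
    set M :=
  if j is Posz n then F n else [set 0].

Definition ngraded (M : weak_module) (F : nat -> set M) : Prop :=
  direct_sum F /\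
  forall (n : int) (a : V), weight_space n a ->
  forall (j : nat) (k : int) (w : M), F j w ->
    extend_grading F (n + j%:Z - k - 1) (mode (@modY M) a k w).

Record ngraded_weak_module := NGraded {
  ng_weak :> weak_module;
  ng_comp : nat -> set ng_weak;
  ng_ngraded : ngraded ng_comp
}.

End VertexOperatorAlgebra.

Arguments voaY {K} V _ _ _ : rename.
Arguments modY {K V} M _ _ _ : rename.
Arguments L0_eigenspace {K V} M lambda _.
Arguments ng_comp {K V} M _ _ : rename.

Section JacobiCoefficients.
Variable K : numFieldType.

Lemma series_mul_monomial (E : zmodType) (M : lmodType K) (J : choiceType)
    (c : J -> K) (d : J -> E) (g : E -> M) (e : E) : injective d ->
  series_mul (monomial_sum c d) g e
    = \sum_(j \in [set: J]) c j *: g (e - d j).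
Proof.
move=> dI; rewrite /series_mul.
rewrite -(@fsbig_widen _ _ _ _ (d @` setT)) //; last first.
  move=> x [_ /= nx]; rewrite /monomial_sum.
  rewrite (_ : [set j | d j = x] = set0) ?fsbig_set0 ?scale0r //.
  by apply/seteqP; split=> // j /= dj; apply: nx; exists j.
rewrite (@reindex_fsbig _ _ _ _ _ d setT); last first.
  split=> [j _|j k _ _|x [j _ <-]]; by [exists j|exact: dI].
apply: eq_fsbigr => j _; rewrite /monomial_sum.
rewrite (_ : [set k | d k = d j] = [set j]) ?fsbig_set1 //.
by apply/seteqP; split=> k /=; [exact: dI|move=> ->].
Qed.

Lemma fsbig_pair_fst (M : lmodType K) (F : int * nat -> M) (n : int) :
  (forall m i, m != n -> F (m, i) = 0) ->
  \sum_(p \in [set: int * nat]) F p = \sum_(i \in [set: nat]) F (n, i).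
Proof.
move=> F0; rewrite -(@fsbig_widen _ _ _ _ [set p | p.1 = n]) //; last first.
  by move=> [m i] [_ /= /eqP mn]; apply: F0.
rewrite (@reindex_fsbig _ _ _ _ _ (fun i => (n, i)) setT) //.
by split=> [//|i j _ _ [] //|[m i] /= ->]; exists i.
Qed.

Lemma fsbig_pred1 (M : lmodType K) (F : nat -> M) (n : nat) :
  (forall i, i != n -> F i = 0) -> \sum_(i \in [set: nat]) F i = F n.
Proof.
move=> F0; rewrite -(@fsbig_widen _ _ _ _ [set n]) ?fsbig_set1 //.
by move=> i [_ /= /eqP]; apply: F0.
Qed.

Lemma fsbig_pred2 (M : lmodType K) (F : nat -> M) :
  (forall i, (1 < i)%N -> F i = 0) ->
  \sum_(i \in [set: nat]) F i = F 0%N + F 1%N.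
Proof.
move=> F0; rewrite (@fsbigE _ _ _ _ _ [:: 0%N; 1%N]) //.
  by rewrite 2!big_cons big_nil !mem_setT; exact: (congr1 _ (addr0 _)).
by case=> [|[|i]] //= _ _; apply: F0.
Qed.

Lemma jacobi_coef (V W1 W2 W3 : lmodType K)
    (Y1 : V -> W1 -> K -> W1) (Y2 : V -> W2 -> K -> W2)
    (Y3 : V -> W3 -> K -> W3) (I : W1 -> W2 -> K -> W3) :
  jacobi_identity Y1 Y2 Y3 I ->
  forall a u v (n m : int) (beta : K),
    \sum_(i \in [set: nat]) (binz K n i * (-1) ^+ i) *:
       Y3 a (I u v (beta - i%:R)) (- m%:~R - 1 - (n%:~R - i%:R))
    - \sum_(i \in [set: nat]) ((-1) ^ n * (binz K n i * (-1) ^+ i)) *: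
       I u (Y2 a v (- m%:~R - 1 - i%:R)) (beta - (n%:~R - i%:R))
    = \sum_(i \in [set: nat]) binz K m i *:
       I (Y1 a u (- n%:~R - 1 - i%:R)) v (beta - (m%:~R - i%:R)).
Proof.
move=> J a u v n m beta.
have inj1 (x y : int) : - x%:~R - 1 = - y%:~R - 1 :> K -> x = y.
  by move=> /(addIr _) /oppr_inj /intr_inj.
have inj2 (i j : nat) : i%:R = j%:R :> K -> i = j.
  by move/eqP; rewrite eqr_nat => /eqP.
have dlt (x y : int) : x != y -> (- y%:~R - 1 - (- x%:~R - 1) == 0 :> K) = false.
  move=> xy; apply: contraNF xy; rewrite subr_eq0 => /eqP /inj1 -> //.
move: (J a u v (- n%:~R - 1, - m%:~R - 1, beta)) => /=.
rewrite !series_mul_monomial.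
- rewrite (fsbig_pair_fst (n := n)); last first.
    by move=> x i xn; rewrite /= dlt // scaler0.
  rewrite (fsbig_pair_fst (n := n)); last first.
    by move=> x i xn; rewrite /= dlt // scaler0.
  rewrite (fsbig_pair_fst (n := m)); last first.
    by move=> x i xn; rewrite /= dlt // scaler0.
  rewrite /= !subrr !eqxx; exact.
- by move=> [x i] [y j] [] /inj2 <- /inj1 <-.
- by move=> [x i] [y j] [] /inj1 <- /inj2 <-.
- by move=> [x i] [y j] [] /inj1 <- _ /inj2 <-.
Qed.

Lemma binz0 (i : nat) : binz K 0 i = (i == 0%N)%:R.
Proof.
rewrite /binz; case: i => [|i]; first by rewrite big_ord0 fact0 divr1.
by rewrite big_ord_recl subrr !mul0r.
Qed.

Lemma binz1 (i : nat) : binz K 1 i = (i < 2)%:R.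
Proof.
rewrite /binz; case: i => [|[|i]]; first by rewrite big_ord0 fact0 divr1.
  by rewrite big_ord_recl big_ord0 subr0 mulr1 divr1.
by rewrite !big_ord_recl /= subrr mul0r mulr0 mul0r.
Qed.

Lemma binzN2 (i : nat) : binz K (- 2%:Z) i * (-1) ^+ i = i.+1%:R.
Proof.
suff -> : binz K (- 2%:Z) i = (-1) ^+ i * i.+1%:R.
  by rewrite mulrAC -expr2 sqrr_sign mul1r.
rewrite /binz; apply: (canLR (mulfK _)); first by rewrite pnatr_eq0 -lt0n fact_gt0.
elim: i => [|i IHi]; first by rewrite big_ord0 fact0 !mulr1.
rewrite big_ord_recr /= IHi factS natrM exprS.
have -> : (- 2%:Z)%:~R = - 2%:R :> K by [].
rewrite -[i.+2]addn1 -[i.+1]addn1 !natrD; ring.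
Qed.

End JacobiCoefficients.

Section ModuleGrading.
Variables (K : numFieldType) (V : voa K).

Lemma linear_fun0 (M N : lmodType K) (f : M -> N) : linear f -> f 0 = 0.
Proof.
move=> fl; have : f (-1 *: 0 + 0) = -1 *: f 0 + f 0 := fl (-1) 0 0.
by rewrite scaler0 addr0 scaleN1r addNr.
Qed.

Lemma linear_funZ (M N : lmodType K) (f : M -> N) c v :
  linear f -> f (c *: v) = c *: f v.
Proof. 
move=> fl; have : f (c *: v + 0) = c *: f v + f 0 := fl c v 0.
by rewrite linear_fun0 // !addr0.
Qed.

(* L(-1) a = a_(-2) 1 *)
Lemma voa_L_1_creation (a : V) :
  Lmode (voaY V) (omega V) (-1) a = voaY V a (vacuum V) 1.
Proof.
have [_ {1}<-] := voaY_creation (Lmode (voaY V) (omega V) (-1) a).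
by rewrite voa_L_1 /derivative add0r scale1r.
Qed.

Lemma modY_derivative (M : weak_module V) (a : V) (w : M) :
  modY M (Lmode (voaY V) (omega V) (-1) a) w = derivative (modY M a w).
Proof.
have [blV blM] := modY_bilinear M.
apply/funext => beta; rewrite voa_L_1_creation /derivative.
have := jacobi_coef (@modY_jacobi _ _ M) a (vacuum V) w (- 2%:Z) 0 beta.
rewrite [X in _ = X -> _](fsbig_pred1 (n := 0%N)); last first.
  by move=> i i0; rewrite binz0 (negbTE i0) scale0r.
rewrite binz0 scale1r !subr0.
have -> : - (- 2%:Z)%:~R - 1 = 1 :> K by rewrite rmorphN /= opprK; ring.
move=> <-.
under eq_fsbigr do rewrite binzN2 modY_vacuum /constant_series.
under [X in _ - X]eq_fsbigr do rewrite binzN2 modY_vacuum /constant_series.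
have s2 : (-1) ^ (- 2%:Z) = 1 :> K by rewrite -exprnN sqrrN expr1n invr1.
have m2 : (- 2%:Z)%:~R = - 2%:R :> K by [].
have [[n ->]|nnat] := pselect (exists n : nat, beta = n%:R).
  rewrite [X in X - _](fsbig_pred1 (n := n)); last first.
    move=> i ni; rewrite subr_eq0 eqr_nat eq_sym (negbTE ni).
    by rewrite (linear_fun0 (blV a)) scaler0.
  rewrite [X in _ - X]fsbig1; last first.
    move=> i _; rewrite m2 -opprD opprK -!natrD pnatr_eq0.
    by rewrite addnC addSn scaler0.
  rewrite subrr eqxx subr0 -natr1 m2; congr (_ *: modY _ _ _ _); ring.
have [[n ->]|nneg] := pselect (exists n : nat, beta = - n.+2%:R).
  rewrite [X in X - _]fsbig1; last first.
    move=> i _; rewrite -opprD oppr_eq0 -natrD pnatr_eq0 addSn.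
    by rewrite (linear_fun0 (blV a)) scaler0.
  rewrite [X in _ - X](fsbig_pred1 (n := n)); last first.
    move=> i ni; rewrite m2 (_ : _ - (_ - i%:R) = i%:R - n%:R :> K); last first.
      by rewrite -[n.+2]addn2 natrD; ring.
    by rewrite subr_eq0 eqr_nat (negbTE ni) scaler0.
  rewrite m2 s2 mul1r -[n.+2]addn2 -[n.+1]addn1 !natrD.
  case: eqP => [_|]; last by case; ring.
  rewrite sub0r -scaleNr; congr (_ *: modY _ _ _ _); ring.
rewrite !fsbig1 ?subr0.
- have [->|b1] := eqVneq beta (-1); first by rewrite addNr scale0r.
  apply/esym; apply: contrapT => nz.
  have {nz} : modY M a w (beta + 1) <> 0 by move=> nz'; apply: nz; rewrite nz' scaler0.
  have [N HN] := modY_laurent a w => /HN [n _ bn].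
  have {}bn : beta = (n - 1)%:~R by rewrite rmorphB /= -bn addrK.
  case: n bn => [[|n]|n] bn.
  + by move: b1; rewrite bn eqxx.
  + by apply: nnat; exists n; rewrite bn -addn1 PoszD addrK.
  + apply: nneg; exists n; rewrite bn NegzE -opprD rmorphN /=.
    by rewrite -[_ + _]/(n.+1 + 1)%:Z addn1.
- move=> i _; case: eqP => [bi|]; last by rewrite scaler0.
  exfalso; apply: nneg; exists i; move/eqP: bi.
  by rewrite m2 subr_eq0 => /eqP ->; rewrite -opprD -natrD addnC addn2.
- move=> i _; case: eqP => [bi|_]; last by rewrite (linear_fun0 (blV a)) scaler0.
  by exfalso; apply: nnat; exists i; move/eqP: bi; rewrite subr_eq0 => /eqP.
Qed.

Lemma L0_commutator (M : weak_module V) (n : int) (a : V) (w : M)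
    (lambda beta : K) : weight_space n a -> L0_eigenspace M lambda w ->
  L0_eigenspace M (lambda + n%:~R + beta) (modY M a w beta).
Proof.
have [blV blM] := modY_bilinear M.
move=> an wl; rewrite /L0_eigenspace /eigenspace_of /= /Lmode /mode.
have := jacobi_coef (@modY_jacobi _ _ M) (omega V) a w 0 1 beta.
rewrite [X in X - _](fsbig_pred1 (n := 0%N)); last first.
  by move=> i i0; rewrite binz0 (negbTE i0) mul0r scale0r.
rewrite [X in _ - X](fsbig_pred1 (n := 0%N)); last first.
  by move=> i i0; rewrite binz0 (negbTE i0) mul0r mulr0 scale0r.
rewrite fsbig_pred2; last first.
  by move=> i i2; rewrite binz1 ltnNge i2 scale0r.
rewrite !binz0 !binz1 /= !expr0 expr0z !mulr1 !scale1r !subr0 subrr subr0.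
have -> : modY M (omega V) w (- 1%:~R - 1) = lambda *: w by exact: wl.
have e1 : voaY V (omega V) a (- 0%:~R - 1) = Lmode (voaY V) (omega V) (-1) a.
  by rewrite /Lmode /mode addNr.
have e2 : voaY V (omega V) a (- 0%:~R - 1 - 1) = n%:~R *: a.
  by rewrite -an /Lmode /mode add0r oppr0 add0r.
rewrite e1 e2 modY_derivative /derivative subrK.
rewrite (linear_funZ lambda w (blV a)).
have -> : modY M (n%:~R *: a) w = n%:~R *: modY M a w by exact: linear_funZ (blM w).
move/eqP; rewrite subr_eq => /eqP; rewrite add0r => ->.
by rewrite !scalerDl addrC [in RHS]addrAC -!addrA; congr (_ + _); rewrite addrC.
Qed.

Lemma direct_sum_eigenvector (M : lmodType K) (L : M -> M) (F : nat -> set M)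
    (mu : nat -> K) (nu : K) (w : M) :
  linear L -> direct_sum F -> (forall j v, F j v -> L v = mu j *: v) ->
  (forall j, mu j != nu) -> L w = nu *: w -> w = 0.
Proof.
move=> Ll [sF dF] Fmu munu Lw.
have [f [[fin fF wE] _]] := dF w.
have fz j : f j = 0.
  have [g [_ gu]] := dF 0.
  have g0 : g = fun=> 0.
    apply: gu; split.
    - by rewrite (_ : [set _ | _] = set0) //; apply/seteqP; split=> // ? /=.
    - by move=> k; have [] := sF k.
    - by rewrite fsbig1.
  have : g = fun k => (mu k - nu) *: f k.
    apply: gu; split.
    - apply: sub_finite_set fin => k /= nz fk; apply: nz.
      by rewrite fk scaler0.
    - move=> k; have [F0 FD] := sF k.
      by rewrite -[X in F k X]addr0; apply: FD.
    - have Lsum (s : seq nat) : L (\sum_(k <- s) f k) = \sum_(k <- s) mu k *: f k.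
        elim: s => [|k s IHs]; first by rewrite !big_nil linear_fun0.
        rewrite !big_cons -IHs -(Fmu k (f k)) //.
        set x := \sum_(j <- s) f j.
        have : L (1 *: f k + x) = 1 *: L (f k) + L x := Ll 1 (f k) x.
        by rewrite !scale1r.
      have supp : [set k | f k <> 0] = [set: nat] `&` f @^-1` [set~ 0].
        by rewrite setTI.
      set s := finite_support 0 [set: nat] f.
      have ws : w = \sum_(k <- s) f k by [].
      rewrite (@fsbigE _ _ _ _ _ s); last first.
      + move=> k _; rewrite /s in_finite_support -?supp // => ks.
        have -> : f k = 0; last by rewrite scaler0.
        by apply: contrapT => fk; move/negP: ks; apply; rewrite inE.
      + by [].
      + exact: finite_support_uniq.
      rewrite (eq_bigl xpredT) => [|k]; last by rewrite mem_setT.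
      under eq_bigr do rewrite scalerBl.
      by rewrite sumrB -Lsum -scaler_sumr -ws Lw subrr.
  rewrite g0 => /(congr1 (@^~ j)) /esym /eqP.
  by rewrite scaler_eq0 subr_eq0 (negbTE (munu j)) => /eqP.
by rewrite wE fsbig1.
Qed.

Lemma L0_grading_ngraded (M : weak_module V) (lambda : K) :
  direct_sum (fun j : nat => L0_eigenspace M (lambda + j%:R)) ->
  ngraded (fun j : nat => L0_eigenspace M (lambda + j%:R)).
Proof.
move=> dM; split=> // n a an j k w wj.
have := L0_commutator (- k%:~R - 1) an wj; rewrite /mode.
set b := modY _ _ _ _; have -> : lambda + j%:R + n%:~R + (- k%:~R - 1) =
    lambda + (n + j%:Z - k - 1)%:~R by rewrite !rmorphB rmorphD /=; ring.
case: (n + j%:Z - k - 1) => [m //|m] bm.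
apply: (direct_sum_eigenvector (L := Lmode (modY M) (omega V) 0)
   (mu := fun j : nat => lambda + j%:R) _ dM _ _ bm) => //.
- by move=> c u v; have [blV _] := modY_bilinear M; rewrite /Lmode /mode blV.
- move=> i; rewrite (inj_eq (addrI _)) NegzE -[i%:R]/(i%:Z%:~R) eqr_int.
  by [].
Qed.

(* W_lambda + W_(lambda+1) + ... as an N-graded weak module, graded by
   W(j) = W_(lambda+j) *)
Definition L0_graded (W : voa_module V) (lambda : K)
    (dW : direct_sum (fun j : nat => L0_eigenspace W (lambda + j%:R))) :
    ngraded_weak_module V :=
  NGraded (L0_grading_ngraded dW).

End ModuleGrading.

Section IntertwiningOperators.
Variables (K : numFieldType) (V : voa K).

(* Linear maps on W1 (x) W2 are represented by bilinear maps on W1 and W2. *)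
Definition intertwining_op (W1 W2 W3 : voa_module V) :
    set (W1 -> W2 -> K -> W3) :=
  [set I | [/\ bilinear_map I,
     (* u_alpha v is the coefficient of x^(-alpha-1) *)
     forall u v (alpha : K), exists N : nat, forall m : nat, (N <= m)%N ->
       I u v (- (alpha + m%:R) - 1) = 0,
     jacobi_identity (modY W1) (modY W2) (modY W3) I
   & forall u v,
       I (Lmode (modY W1) (omega V) (-1) u) v = derivative (I u v)]].

End IntertwiningOperators.

Arguments intertwining_op {K V} W1 W2 W3 _.

Section Iota.
Variables (K : numFieldType) (M : lmodType K).

(* An element
     x^-lf_x y^-lf_y (x - y)^-lf_xy \sum_(j, k) lf_num j k x^j y^k
   of M[[x, y]][x^-1, y^-1, (x - y)^-1], written as a fraction.  The expansions
   below do not depend on the fraction chosen, so that asking for a fraction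
   with given expansions is asking for an element with these expansions. *)
Record loc_series := LocSeries {
  lf_num : nat -> nat -> M;
  lf_x : nat;
  lf_y : nat;
  lf_xy : nat
}.

(* Expansions of x^j y^k (x - y)^l; the exponents are those of (x, y), except
   in the last one, where they are those of (x, y - x). *)
Definition iota_xy_monomial (j k l : int) : K * K -> K :=
  monomial_sum (fun i : nat => binz K l i * (-1) ^+ i)
               (fun i : nat => ((j + l - i%:Z)%:~R, (k + i%:Z)%:~R)).

Definition iota_yx_monomial (j k l : int) : K * K -> K :=
  monomial_sum (fun i : nat => binz K l i * (-1) ^ (l - i%:Z))
               (fun i : nat => ((j + i%:Z)%:~R, (k + l - i%:Z)%:~R)).

Definition iota_x_yx_monomial (j k l : int) : K * K -> K :=
  monomial_sum (fun i : nat => binz K k i * (-1) ^ l)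
               (fun i : nat => ((j + k - i%:Z)%:~R, (l + i%:Z)%:~R)).

Definition iota_extend (mon : int -> int -> int -> K * K -> K)
    (f : loc_series) : K * K -> M :=
  fun e => \sum_(p \in [set: nat * nat])
    mon (p.1%:Z - (lf_x f)%:Z) (p.2%:Z - (lf_y f)%:Z) (- (lf_xy f)%:Z) e
      *: lf_num f p.1 p.2.

Definition iota_xy := iota_extend iota_xy_monomial.
Definition iota_yx := iota_extend iota_yx_monomial.
Definition iota_x_yx := iota_extend iota_x_yx_monomial.

End Iota.

Section ZGradedIntertwiningOperators.
Variables (K : numFieldType) (V : voa K).

Definition zgraded_intertwining_op (W1 W2 W3 : ngraded_weak_module V) :
    set (W1 -> W2 -> K -> W3) :=
  [set Phi | [/\ bilinear_map Phi, forall u v, laurent (Phi u v),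
     (* Phi(u; k) v is the coefficient of x^(-k-1) *)
     forall (i j : nat) (k : int) (u : W1) (v : W2),
       ng_comp W1 i u -> ng_comp W2 j v ->
       extend_grading (ng_comp W3) (i%:Z + j%:Z - k - 1)
         (Phi u v (- k%:~R - 1))
   & forall (u : W1) (v : W2) (a : V), exists F : loc_series W3,
       [/\ iota_xy F =
             (fun e : K * K => let '(ex, ey) := e in
                Phi u (modY W2 a v ey) ex),
           iota_yx F =
             (fun e : K * K => let '(ex, ey) := e in
                modY W3 a (Phi u v ex) ey)
         & iota_x_yx F =
             (fun e : K * K => let '(ex, eyx) := e in
                Phi (modY W1 a u eyx) v ex)]]].

End ZGradedIntertwiningOperators.

Arguments zgraded_intertwining_op {K V} W1 W2 W3 _.

(* Main.v *)
Require Import Defs.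
From mathcomp Require Import all_boot all_order all_algebra.
From mathcomp Require Import complex finmap ring zify.
From mathcomp Require Import boolp classical_sets functions cardinality fsbigop.
From mathcomp Require Import reals.

Set Implicit Arguments.
Unset Strict Implicit.
Unset Printing Implicit Defensive.

Import Order.TTheory GRing.Theory Num.Theory.
Local Open Scope classical_set_scope.
Local Open Scope ring_scope.

(* Both the Jacobi identity and the rationality axiom are about the three series
   I(u, x) Y(a, y) v, Y(a, y) I(u, x) v and I(Y(a, y - x) u, x) v, and they are
   equivalent as soon as x^c I(u, x) v, with c = lambda1 + lambda2 - lambda3, is
   a Laurent series.  Multiplying the three series by y - x, or by y, shifts an
   index of the Jacobi identity, which reduces the identity for a fraction
   x^j y^k (x - y)^l to the residue theorem in the variable y.

   It remains to compare the L(-1)-derivative property with the grading.  The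
   x_1-residue of the Jacobi identity for a = omega expresses the commutator of
   L(0) with I(u, x) through I(L(-1) u, x) and I(L(0) u, x).  Hence, for
   homogeneous u and v, the derivative property holds exactly when the
   coefficient of x^beta in I(u, x) v has weight wt u + wt v + beta; and since
   the weights of W3 are in lambda3 + N, this is the grading condition and
   forces x^c I(u, x) v to be a Laurent series. *)

(** * Linearity of finitely supported sums *)

Section FinitelySupportedSums.
Variables (K : numFieldType) (M : lmodType K).

(** [\sum_(_ \in _)] is 0 on a family of infinite support, so sums may be combined or split only
    under this condition. *)
Definition fin_supp (J : choiceType) (F : J -> M) : Prop :=
  finite_set [set j | F j <> 0].

Lemma fin_supp_sub (J : choiceType) (F : J -> M) (A : set J) :
  finite_set A -> (forall j, ~ A j -> F j = 0) -> fin_supp F.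
Proof.
move=> fA FA; apply: sub_finite_set fA => j /= Fj.
by apply: contrapT => /FA.
Qed.

Lemma fin_supp_nat (F : nat -> M) (N : nat) :
  (forall i, (N <= i)%N -> F i = 0) -> fin_supp F.
Proof.
move=> F0; apply: (fin_supp_sub (finite_II N)) => i /= /negP.
by rewrite -leqNgt => /F0.
Qed.

Lemma fin_suppZ (J : choiceType) (k : J -> K) (F : J -> M) :
  fin_supp F -> fin_supp (fun j => k j *: F j).
Proof.
move=> fF; apply: (fin_supp_sub fF) => j /= /contrapT ->.
by rewrite scaler0.
Qed.

(** All three sums can be taken over the union of the two supports, which is finite. *)
Lemma fsbig_linear (J : choiceType) (c : K) (F G : J -> M) :
  fin_supp F -> fin_supp G ->
  \sum_(j \in [set: J]) (c *: F j + G j)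
  = c *: \sum_(j \in [set: J]) F j + \sum_(j \in [set: J]) G j.
Proof.
move=> fF fG; set A := [set j | F j <> 0] `|` [set j | G j <> 0].
have fA : finite_set A by rewrite finite_setU.
have F0 j : ~ A j -> F j = 0 by move=> nA; apply: contrapT => ?; apply: nA; left.
have G0 j : ~ A j -> G j = 0 by move=> nA; apply: contrapT => ?; apply: nA; right.
have w (H : J -> M) : (forall j, ~ A j -> H j = 0) ->
    \sum_(j \in [set: J]) H j = \sum_(j <- fset_set A) H j.
  move=> H0; rewrite -(@fsbig_widen _ _ _ _ A) //; first exact: fsbig_finite.
  by move=> j [_ /H0].
rewrite !w //; first by rewrite big_split scaler_sumr.
by move=> j nA; rewrite F0 // G0 // scaler0 addr0.
Qed.

Lemma fsbig_nat_recl (F : nat -> M) : fin_supp F ->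
  \sum_(i \in [set: nat]) F i = F 0%N + \sum_(i \in [set: nat]) F i.+1.
Proof.
move=> fF.
have -> : F 0%N = \sum_(i \in [set: nat]) (if i == 0%N then F i else 0).
  by rewrite (fsbig_pred1 (n := 0%N)) ?eqxx // => i /negbTE ->.
have -> : \sum_(i \in [set: nat]) F i.+1
    = \sum_(i \in [set: nat]) (if i == 0%N then 0 else F i).
  rewrite -[RHS](@fsbig_widen _ _ _ _ [set i.+1 | i in [set: nat]]) //.
    by rewrite (@reindex_fsbig _ _ _ _ _ S setT) //; split=> [i _|i j _ _ []|i];
      [exists i|exact|].
  by move=> [|i] [_ /= ni] //; case: ni; exists i.
rewrite -[X in X + _]scale1r -fsbig_linear; last 2 first.
- by apply: (fin_supp_sub (finite_set1 0%N)) => j /= /eqP /negbTE ->.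
- by apply: (fin_supp_sub fF) => j /= /contrapT ->; case: ifP.
apply: eq_fsbigr => i _; rewrite scale1r.
by case: ifP; rewrite ?addr0 ?add0r.
Qed.

End FinitelySupportedSums.

(** * Binomial coefficients with integer arguments and the residue theorem *)

Section GeneralizedBinomials.
Variable K : numFieldType.

Lemma binz_0r (n : int) : binz K n 0 = 1.
Proof. by rewrite /binz big_ord0 fact0 divr1. Qed.

(** With P = n (n-1) ... (n-i+1), the three numerators are (n+1) P, P (n-i) and P, so that only n +
    1 = (n - i) + (i + 1) remains. *)
Lemma binz_pascal (n : int) (i : nat) :
  binz K (n + 1) i.+1 = binz K n i.+1 + binz K n i.
Proof.
rewrite /binz [in LHS]big_ord_recl [in RHS]big_ord_recr /=.
rewrite (eq_bigr (fun j : 'I_i => n%:~R - j%:R)) => [|j _]; last first.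
  by rewrite /bump /= natrD rmorphD /=; ring.
set P := \prod_(_ < _) _.
rewrite factS natrM rmorphD /= subr0 -[i.+1]addn1 natrD.
field; rewrite !(pnatr_eq0, natr1) /= -?lt0n ?fact_gt0 //.
Qed.

(** Extending by 0 to negative lower indices lets these indices be differences of exponents, and
    Pascal's rule then holds without exception. *)
Definition binZ (n i : int) : K := if i is Posz i then binz K n i else 0.

Lemma binZ_lt0 (n i : int) : i < 0 -> binZ n i = 0.
Proof. by case: i. Qed.

Lemma binZ_pascal (n i : int) : binZ (n + 1) i = binZ n i + binZ n (i - 1).
Proof.
case: i => [[|i]|i]; last by rewrite /= addr0.
  by rewrite /= !binz_0r addr0.
rewrite (_ : i.+1%:Z - 1 = i%:Z); last by lia.
exact: binz_pascal.
Qed.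

Lemma binZ0 (i : int) : binZ 0 i = (i == 0)%:R.
Proof. by case: i => [i|i] //=; rewrite binz0. Qed.

Lemma binz_nat (n i : nat) : binz K n i = 'C(n, i)%:R.
Proof.
elim: n i => [|n IHn] [|i]; rewrite ?binz_0r ?bin0 ?binz0 ?bin0n //.
by rewrite -addn1 PoszD binz_pascal !IHn addn1 binS natrD.
Qed.

(** Pascal's rule is solved for the smaller upper argument, by induction on i and, inside, on n. *)
Lemma binz_neg (n i : nat) : binz K (- n.+1%:Z) i = (-1) ^+ i * 'C(n + i, i)%:R.
Proof.
elim: i n => [|i IHi] n; first by rewrite binz_0r addn0 bin0 mulr1.
elim: n => [|n IHn].
  have := binz_pascal (-1) i.
  rewrite (_ : -1 + 1 = 0 :> int) // binz0 /= IHi add0n !binn !mulr1 => /eqP.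
  by rewrite eq_sym addr_eq0 => /eqP ->; rewrite exprS mulN1r.
have := binz_pascal (- n.+2%:Z) i.
rewrite (_ : - n.+2%:Z + 1 = - n.+1%:Z); last by lia.
rewrite IHn IHi => /esym /(canRL (addrK _)) ->.
rewrite !addSn !addnS [in RHS]binS natrD exprS; ring.
Qed.

Lemma signz (i : int) : (-1) ^ (- i) = (-1) ^ i :> K.
Proof. by rewrite -exprz_inv invrN1. Qed.

Lemma signzS (i : int) : (-1) ^ (i + 1) = - (-1) ^ i :> K.
Proof. by rewrite expfzDr ?oppr_eq0 ?oner_eq0 // expr1z mulrN1. Qed.

Lemma signzB (i : int) : (-1) ^ (i - 1) = - (-1) ^ i :> K.
Proof. by rewrite -[in RHS](subrK 1 i) signzS opprK. Qed.

(* The residue theorem for y^k (x - y)^l: its residues in y at y = x, y = 0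
   and y = infinity add up to 0. *)
Lemma binZ_residue (k l : int) :
  (-1) ^ (- k - 1) * (binZ l (k + l + 1) - binZ l (- k - 1))
  = (-1) ^ l * binZ k (- l - 1).
Proof.
case: l => l.
(* Here there is no pole at y = x. The two lower indices on the left add up to l, so the binomials
   agree by symmetry, or both vanish out of range. *)
- rewrite (_ : - l%:Z - 1 = Negz l) ?NegzE /= ?mulr0; last by lia.
  suff -> : binZ l (k + l + 1) = binZ l (- k - 1) by rewrite subrr mulr0.
  case: k => k.
    rewrite (_ : - k%:Z - 1 = Negz k); last by lia.
    rewrite (_ : k%:Z + l + 1 = (k + l).+1%:Z) /=; last by lia.
    by rewrite binz_nat bin_small //; lia.
  rewrite (_ : - Negz k - 1 = k%:Z) ?NegzE /=; last by lia.
  have [kl|lk] := leqP k l.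
    rewrite (_ : - k.+1%:Z + l + 1 = (l - k)%N%:Z) /=; last by lia.
    by rewrite !binz_nat bin_sub.
  rewrite (_ : - k.+1%:Z + l + 1 = Negz (k - l).-1) /=; last by lia.
  by rewrite binz_nat bin_small.
(* The exponent of x - y is now -(l+1). If k is nonnegative, there is no pole at y = 0 and both
   sides are ['C(k, l)] up to sign. If it is -(k+1), there is no residue at infinity and [binz_neg]
   gives the symmetric pair ['C(k + l, k)], ['C(k + l, l)]. *)
- rewrite NegzE (_ : - - l.+1%:Z - 1 = l%:Z); last by lia.
  have sgn (a b : nat) : (-1) ^+ a * (-1) ^+ b = (-1) ^+ (a + b) :> K.
    by rewrite exprD.
  case: k => k.
    rewrite (_ : - k%:Z - 1 = - k.+1%:Z) ?signz; last by lia.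
    rewrite subr0 -exprnP -[binZ k l]/(binz K k l) binz_nat.
    have [lk|kl] := leqP l k; last first.
      rewrite bin_small // mulr0 (_ : k%:Z + _ + 1 = Negz (l - k).-1) /=; last by lia.
      by rewrite mulr0.
    rewrite (_ : k%:Z + _ + 1 = (k - l)%N%:Z) /=; last by lia.
    rewrite binz_neg mulrA sgn subnKC // bin_sub //; congr (_ * _).
    rewrite -exprnP -signr_odd -[in RHS]signr_odd; congr (_ ^+ _); lia.
  rewrite NegzE (_ : - - k.+1%:Z - 1 = k%:Z); last by lia.
  rewrite (_ : - k.+1%:Z + _ + 1 = Negz (k + l)); last by lia.
  rewrite /= sub0r signz -!exprnP !binz_neg mulrN !mulrA !sgn -mulNr.
  rewrite addnC -bin_sub ?leq_addr // addKn [(k + l)%N]addnC.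
  by rewrite addSn exprS mulN1r !addnn -!muln2 !exprM !sqrr_sign.
Qed.

End GeneralizedBinomials.

(** * Coefficients of the Jacobi identity and their index shifts *)

Section TwoVariableSeries.
Variables (K : numFieldType) (M : lmodType K).

(* f, g and h stand for I(u, x) Y(a, y) v, Y(a, y) I(u, x) v and
   I(Y(a, y - x) u, x) v.  The arguments are the exponents of x and of y, except
   for h, where they are those of x and of y - x. *)
Implicit Types f g h : int -> int -> M.

(** A pole bound uniform in the other exponent. It makes the sums below finite and later allows y -
    x to be cancelled. *)
Definition bounded_fst f : Prop :=
  exists N : nat, forall p q, p < - N%:Z -> f p q = 0.

Definition bounded_snd f : Prop :=
  exists N : nat, forall p q, q < - N%:Z -> f p q = 0.

Definition mul_ysubx f p q : M := f p (q - 1) - f (p - 1) q.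

(** This is multiplication by y on f and g, but by y - x on h. *)
Definition mul_snd f p q : M := f p (q - 1).

(** On h this is multiplication by y = x + (y - x). *)
Definition mul_add f p q : M := f (p - 1) q + f p (q - 1).

(* The coefficients of x_0^(-n-1) x_1^(-m-1) x_2^b in the three terms of the
   Jacobi identity, where y = x_1 and x = x_2. *)
Definition jac_yx g (n m b : int) : M :=
  \sum_(i \in [set: nat]) binz K n i *:
    ((-1) ^+ i *: g (b - i%:Z) (- m - 1 - n + i%:Z)).

Definition jac_xy f (n m b : int) : M :=
  \sum_(i \in [set: nat]) binz K n i *:
    ((-1) ^ n *: ((-1) ^+ i *: f (b - n + i%:Z) (- m - 1 - i%:Z))).

Definition jac_xz h (n m b : int) : M :=
  \sum_(i \in [set: nat]) binz K m i *: h (b - m + i%:Z) (- n - 1 - i%:Z).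

Definition borcherds f g h n m b : Prop :=
  jac_yx g n m b - jac_xy f n m b = jac_xz h n m b.

Lemma jac_yx_supp g n m b : bounded_fst g -> fin_supp (fun i : nat =>
  (-1) ^+ i *: g (b - i%:Z) (- m - 1 - n + i%:Z) : M).
Proof.
move=> [N gN]; apply: (fin_supp_nat (N := (`|b| + N).+1)) => i ib.
by rewrite gN ?scaler0 //; lia.
Qed.

Lemma jac_xy_supp f n m b : bounded_snd f -> fin_supp (fun i : nat =>
  (-1) ^ n *: ((-1) ^+ i *: f (b - n + i%:Z) (- m - 1 - i%:Z)) : M).
Proof.
move=> [N fN]; apply: (fin_supp_nat (N := (`|m| + N).+1)) => i im.
by rewrite fN ?scaler0 //; lia.
Qed.

Lemma jac_xz_supp h n m b : bounded_snd h -> fin_supp (fun i : nat =>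
  h (b - m + i%:Z) (- n - 1 - i%:Z) : M).
Proof.
move=> [N hN]; apply: (fin_supp_nat (N := (`|n| + N).+1)) => i im.
by rewrite hN //; lia.
Qed.

(** Pascal's rule is moved from the coefficients onto the family by summation by parts; in this
    form, raising an index of the Jacobi identity becomes multiplication of a series. *)
Lemma fsbig_binz_pascal (n : int) (G : nat -> M) : fin_supp G ->
  \sum_(i \in [set: nat]) binz K (n + 1) i *: G i
  = \sum_(i \in [set: nat]) binz K n i *: (G i + G i.+1).
Proof.
move=> fG.
have fGS : fin_supp (fun i => G i.+1).
  have [/= A fA] : exists A : set nat, finite_set A /\ forall i, ~ A i -> G i.+1 = 0.
    exists (S @^-1` [set j | G j <> 0]); split.
      by apply: finite_preimage fG => i j _ _ [].
    by move=> i /= /contrapT.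
  by case: fA => fA; exact: fin_supp_sub.
have sD (F F' : nat -> M) : fin_supp F -> fin_supp F' ->
    \sum_(i \in [set: nat]) F i + \sum_(i \in [set: nat]) F' i
    = \sum_(i \in [set: nat]) (F i + F' i).
  move=> fF fF'; rewrite -[X in X + _]scale1r -fsbig_linear //.
  by apply: eq_fsbigr => i _; rewrite scale1r.
have fz (k : nat -> K) : fin_supp (fun i => k i *: G i) by exact: fin_suppZ.
have fzS (k : nat -> K) : fin_supp (fun i => k i *: G i.+1) by exact: fin_suppZ.
rewrite fsbig_nat_recl //.
transitivity (binz K n 0 *: G 0%N + \sum_(i \in [set: nat]) binz K n i.+1 *: G i.+1
    + \sum_(i \in [set: nat]) binz K n i *: G i.+1).
  rewrite !binz_0r -addrA sD //; congr (_ + _).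
  by apply: eq_fsbigr => i _; rewrite binz_pascal scalerDl.
rewrite -(fsbig_nat_recl (F := fun i => binz K n i *: G i)) // sD //.
by apply: eq_fsbigr => i _; rewrite scalerDr.
Qed.

Lemma jac_yxS g n m b : bounded_fst g ->
  jac_yx g (n + 1) m b = jac_yx (mul_ysubx g) n m b.
Proof.
move=> bg; rewrite /jac_yx fsbig_binz_pascal; last exact: jac_yx_supp.
apply: eq_fsbigr => i _; congr (_ *: _).
rewrite exprS mulN1r scaleNr -scalerBr /mul_ysubx; congr (_ *: (g _ _ - g _ _)); lia.
Qed.

Lemma jac_xyS f n m b : bounded_snd f ->
  jac_xy f (n + 1) m b = jac_xy (mul_ysubx f) n m b.
Proof.
move=> bf; rewrite /jac_xy fsbig_binz_pascal; last exact: jac_xy_supp.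
apply: eq_fsbigr => i _; congr (_ *: _).
rewrite signzS exprS mulN1r !scaleNr scalerN opprK addrC -!scalerBr /mul_ysubx.
congr (_ *: (_ *: (f _ _ - f _ _))); lia.
Qed.

Lemma jac_xz_mul_snd h n m b : jac_xz h (n + 1) m b = jac_xz (mul_snd h) n m b.
Proof.
by apply: eq_fsbigr => i _; congr (_ *: h _ _); lia.
Qed.

(** Raising n multiplies the identity by x_0, which the delta functions on the left turn into x_1 -
    x_2 = y - x. *)
Lemma borcherdsS f g h n m b : bounded_snd f -> bounded_fst g ->
  borcherds f g h (n + 1) m b
  <-> borcherds (mul_ysubx f) (mul_ysubx g) (mul_snd h) n m b.
Proof.
by move=> bf bg; rewrite /borcherds jac_yxS // jac_xyS // jac_xz_mul_snd.
Qed.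

(** Raising m multiplies the identity by x_1 = y, which the delta function on the right turns into
    x_2 + x_0. *)
Lemma borcherds_mul_snd f g h n m b : bounded_snd h ->
  borcherds f g h n (m + 1) b
  <-> borcherds (mul_snd f) (mul_snd g) (mul_add h) n m b.
Proof.
move=> bh; rewrite /borcherds /jac_xz fsbig_binz_pascal; last exact: jac_xz_supp.
have -> : jac_yx g n (m + 1) b = jac_yx (mul_snd g) n m b.
  by apply: eq_fsbigr => i _; congr (_ *: (_ *: g _ _)); lia.
have -> : jac_xy f n (m + 1) b = jac_xy (mul_snd f) n m b.
  by apply: eq_fsbigr => i _; congr (_ *: (_ *: (_ *: f _ _))); lia.
set s := (X in _ = X); set t := (X in _ <-> _ = X).
suff -> : s = t by [].
apply: eq_fsbigr => i _; congr (_ *: (h _ _ + h _ _)); lia.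
Qed.

Lemma borcherds00 f g h b :
  borcherds f g h 0 0 b <-> g b (- 1) - f b (- 1) = h b (- 1).
Proof.
rewrite /borcherds /jac_yx /jac_xy /jac_xz.
do 3![rewrite (fsbig_pred1 (n := 0%N)); last first;
  first by move=> i i0; rewrite binz0 (negbTE i0) scale0r].
by rewrite binz0 expr0z expr0 !scale1r !(addr0, subr0).
Qed.

Lemma borcherds_linear f g h f' g' h' (c : K) n m b :
  bounded_snd f -> bounded_fst g -> bounded_snd h ->
  bounded_snd f' -> bounded_fst g' -> bounded_snd h' ->
  borcherds f g h n m b -> borcherds f' g' h' n m b ->
  borcherds (fun p q => c *: f p q + f' p q) (fun p q => c *: g p q + g' p q)
    (fun p q => c *: h p q + h' p q) n m b.
Proof.
move=> bf bg bh bf' bg' bh' J J'.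
have sc (J0 : choiceType) (k : J0 -> K) (F G : J0 -> M) : fin_supp F -> fin_supp G ->
    \sum_(j \in [set: J0]) k j *: (c *: F j + G j)
  = c *: \sum_(j \in [set: J0]) k j *: F j + \sum_(j \in [set: J0]) k j *: G j.
  move=> fF fG; rewrite -fsbig_linear; try exact: fin_suppZ.
  by apply: eq_fsbigr => j _; rewrite scalerDr !scalerA mulrC.
have sD (k : K) (u v : M) : k *: (c *: u + v) = c *: (k *: u) + k *: v.
  by rewrite scalerDr !scalerA mulrC.
have Jg : jac_yx (fun p q => c *: g p q + g' p q) n m b
    = c *: jac_yx g n m b + jac_yx g' n m b.
  rewrite /jac_yx -sc; try exact: jac_yx_supp.
  by apply: eq_fsbigr => i _; congr (_ *: _); exact: sD.
have Jf : jac_xy (fun p q => c *: f p q + f' p q) n m b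
    = c *: jac_xy f n m b + jac_xy f' n m b.
  rewrite /jac_xy -sc; try exact: jac_xy_supp.
  by apply: eq_fsbigr => i _; congr (_ *: _); rewrite !sD.
have Jh : jac_xz (fun p q => c *: h p q + h' p q) n m b
    = c *: jac_xz h n m b + jac_xz h' n m b.
  by rewrite /jac_xz -sc //; exact: jac_xz_supp.
by rewrite /borcherds Jg Jf Jh -J -J' scalerBr opprD addrACA.
Qed.

End TwoVariableSeries.

(** * The three expansions of a fraction *)

Section Expansions.
Variables (K : numFieldType) (M : lmodType K).

(* The coefficients of x^p y^q, respectively x^p (y - x)^q, in the expansions
   of x^j y^k (x - y)^l. *)
Definition mon_xy (j k l p q : int) : K :=
  (j + k + l == p + q)%:R * (binZ K l (q - k) * (-1) ^ (q - k)).

Definition mon_yx (j k l p q : int) : K :=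
  (j + k + l == p + q)%:R * (binZ K l (p - j) * (-1) ^ (l - (p - j))).

Definition mon_xz (j k l p q : int) : K :=
  (j + k + l == p + q)%:R * (binZ K k (q - l) * (-1) ^ l).

(** The exponents a, b, l are arbitrary integers, so that multiplying or dividing by y or y - x
    stays inside this family. *)
Definition expand (mon : int -> int -> int -> int -> int -> K)
    (w : nat -> nat -> M) (a b l p q : int) : M :=
  \sum_(r \in [set: nat * nat]) mon (r.1%:Z + a) (r.2%:Z + b) l p q *: w r.1 r.2.

Definition homogeneous (mon : int -> int -> int -> int -> int -> K) : Prop :=
  forall j k l p q, j + k + l != p + q -> mon j k l p q = 0.

Lemma homogeneous_xy : homogeneous mon_xy.
Proof. by move=> j k l p q /negbTE; rewrite /mon_xy => ->; rewrite mul0r. Qed.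

Lemma homogeneous_yx : homogeneous mon_yx.
Proof. by move=> j k l p q /negbTE; rewrite /mon_yx => ->; rewrite mul0r. Qed.

Lemma homogeneous_xz : homogeneous mon_xz.
Proof. by move=> j k l p q /negbTE; rewrite /mon_xz => ->; rewrite mul0r. Qed.

(** Homogeneity fixes the sum of the two natural indices, which leaves finitely many pairs. *)
Lemma expand_supp mon w a b l p q : homogeneous mon ->
  fin_supp (fun r : nat * nat =>
    mon (r.1%:Z + a) (r.2%:Z + b) l p q *: w r.1 r.2 : M).
Proof.
move=> hm; set N := (`|(p + q - a - b - l)%R|%N + `|a|%N + `|b|%N).+1.
apply: (fin_supp_sub (finite_setX (finite_II N) (finite_II N))).
move=> [s t] /= /not_andP st; rewrite hm ?scale0r //.
apply/negP => /eqP e.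
by case: st => /negP; lia.
Qed.

Lemma expand_linear (c : K) mon mon' mon'' w w'' a b l p q p' q' a'' b'' l'' p'' q'' :
  homogeneous mon -> homogeneous mon' ->
  (forall s t : nat,
    (c * mon (s%:Z + a) (t%:Z + b) l p q + mon' (s%:Z + a) (t%:Z + b) l p' q')
      *: w s t
    = mon'' (s%:Z + a'') (t%:Z + b'') l'' p'' q'' *: w'' s t) ->
  c *: expand mon w a b l p q + expand mon' w a b l p' q'
  = expand mon'' w'' a'' b'' l'' p'' q''.
Proof.
move=> hm hm' E; rewrite -fsbig_linear; try exact: expand_supp.
by apply: eq_fsbigr => -[s t] _ /=; rewrite scalerA -scalerDl E.
Qed.

Lemma expandE mon mon'' w w'' a b l p q a'' b'' l'' p'' q'' :
  (forall s t : nat, mon (s%:Z + a) (t%:Z + b) l p q *: w s t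
    = mon'' (s%:Z + a'') (t%:Z + b'') l'' p'' q'' *: w'' s t) ->
  expand mon w a b l p q = expand mon'' w'' a'' b'' l'' p'' q''.
Proof. by move=> E; apply: eq_fsbigr => -[s t] _ /=; rewrite E. Qed.

Lemma bounded_expand_xy w a b l : bounded_snd (expand mon_xy w a b l).
Proof.
exists `|b|%N => p q qb; apply: fsbig1 => -[s t] _ /=.
by rewrite /mon_xy binZ_lt0 ?mul0r ?mulr0 ?scale0r //; lia.
Qed.

Lemma bounded_expand_yx w a b l : bounded_fst (expand mon_yx w a b l).
Proof.
exists `|a|%N => p q qb; apply: fsbig1 => -[s t] _ /=.
by rewrite /mon_yx binZ_lt0 ?mul0r ?mulr0 ?scale0r //; lia.
Qed.

Lemma bounded_expand_xz w a b l : bounded_snd (expand mon_xz w a b l).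
Proof.
exists `|l|%N => p q ql; apply: fsbig1 => -[s t] _ /=.
by rewrite /mon_xz binZ_lt0 ?mul0r ?mulr0 ?scale0r //; lia.
Qed.

(** The numerator changes sign because y - x = -(x - y); on coefficients this is Pascal's rule in
    the exponent l. *)
Lemma mul_ysubx_xy w a b l :
  mul_ysubx (expand mon_xy w a b l) = expand mon_xy (fun s t => - w s t) a b (l + 1).
Proof.
apply/funext => p; apply/funext => q.
rewrite /mul_ysubx addrC -scaleN1r; apply: expand_linear; try exact: homogeneous_xy.
move=> s t; rewrite scalerN -scaleNr; congr (_ *: _).
set j := _ + a; set k := _ + b; rewrite /mon_xy binZ_pascal.
rewrite (_ : q - 1 - k = q - k - 1) ?signzB; last by lia.
rewrite (_ : (_ + l == p + (q - 1)) = (j + k + (l + 1) == p + q)); last by lia.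
rewrite (_ : (_ + l == p - 1 + q) = (j + k + (l + 1) == p + q)); last by lia.
ring.
Qed.

Lemma mul_ysubx_yx w a b l :
  mul_ysubx (expand mon_yx w a b l) = expand mon_yx (fun s t => - w s t) a b (l + 1).
Proof.
apply/funext => p; apply/funext => q.
rewrite /mul_ysubx addrC -scaleN1r; apply: expand_linear; try exact: homogeneous_yx.
move=> s t; rewrite scalerN -scaleNr; congr (_ *: _).
set j := _ + a; set k := _ + b; rewrite /mon_yx binZ_pascal.
rewrite (_ : l - (p - 1 - j) = l - (p - j) + 1) ?signzS; last by lia.
rewrite (_ : l + 1 - (p - j) = l - (p - j) + 1) ?signzS; last by lia.
rewrite (_ : p - 1 - j = p - j - 1); last by lia.
rewrite (_ : (_ + l == p + (q - 1)) = (j + k + (l + 1) == p + q)); last by lia.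
rewrite (_ : (_ + l == p - 1 + q) = (j + k + (l + 1) == p + q)); last by lia.
ring.
Qed.

Lemma mul_snd_xz w a b l :
  mul_snd (expand mon_xz w a b l) = expand mon_xz (fun s t => - w s t) a b (l + 1).
Proof.
apply/funext => p; apply/funext => q; apply: expandE => s t.
rewrite scalerN -scaleNr; congr (_ *: _).
set j := _ + a; set k := _ + b; rewrite /mon_xz signzS.
rewrite (_ : q - (l + 1) = q - 1 - l); last by lia.
rewrite (_ : (_ + l == p + (q - 1)) = (j + k + (l + 1) == p + q)); last by lia.
ring.
Qed.

Lemma mul_snd_xy w a b l :
  mul_snd (expand mon_xy w a b l) = expand mon_xy w a (b + 1) l.
Proof.
apply/funext => p; apply/funext => q; apply: expandE => s t.
congr (_ *: _); rewrite /mon_xy (_ : q - 1 - (t%:Z + b) = q - (t%:Z + (b + 1))); last by lia.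
congr ((nat_of_bool _)%:R * _); lia.
Qed.

Lemma mul_snd_yx w a b l :
  mul_snd (expand mon_yx w a b l) = expand mon_yx w a (b + 1) l.
Proof.
apply/funext => p; apply/funext => q; apply: expandE => s t.
by congr (_ *: _); rewrite /mon_yx; congr ((nat_of_bool _)%:R * _); lia.
Qed.

(** In this expansion y^k is (x + (y - x))^k, so that Pascal's rule is applied to k. *)
Lemma mul_add_xz w a b l :
  mul_add (expand mon_xz w a b l) = expand mon_xz w a (b + 1) l.
Proof.
apply/funext => p; apply/funext => q; rewrite /mul_add -[X in X + _]scale1r.
apply: expand_linear; try exact: homogeneous_xz.
move=> s t; congr (_ *: _).
rewrite /mon_xz [t%:Z + (b + 1)]addrA binZ_pascal.
rewrite (_ : q - 1 - l = q - l - 1); last by lia.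
rewrite (_ : (_ + l == p - 1 + q) = (s%:Z + a + (t%:Z + b + 1) + l == p + q)); last by lia.
rewrite (_ : (_ + l == p + (q - 1)) = (s%:Z + a + (t%:Z + b + 1) + l == p + q)); last by lia.
ring.
Qed.

(** Monomial by monomial this is [binZ_residue]; outside total degree p - 1 all three coefficients
    vanish. *)
Lemma residue_expand w a b l p :
  expand mon_yx w a b l p (-1) - expand mon_xy w a b l p (-1)
  = expand mon_xz w a b l p (-1).
Proof.
rewrite addrC -scaleN1r.
apply: expand_linear; [exact: homogeneous_xy|exact: homogeneous_yx|move=> s t].
congr (_ *: _); rewrite mulN1r addrC.
set j := _ + a; set k := _ + b; rewrite /mon_yx /mon_xy /mon_xz -mulrBr.
have [e|_] := eqVneq (j + k + l) (p - 1); last by rewrite !mul0r.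
rewrite (_ : p - j = k + l + 1); last by lia.
rewrite (_ : l - (k + l + 1) = - k - 1); last by lia.
rewrite (_ : -1 - k = - k - 1); last by lia.
rewrite (_ : -1 - l = - l - 1); last by lia.
by rewrite !mul1r -mulrBl mulrC binZ_residue mulrC.
Qed.

(** Without a power of x - y nothing is expanded, and the numerator, shifted by A and B to natural
    indices, can be read off. *)
Lemma expand_mon0 mon (P : int -> int -> M) (A B : nat) (w : nat -> nat -> M)
    (p q : int) :
  (forall j k : int, mon j k 0 p q = ((j == p) && (k == q))%:R) ->
  (forall s t : nat, w s t = P (s%:Z - A%:Z) (t%:Z - B%:Z)) ->
  (forall p q, (p < - A%:Z) || (q < - B%:Z) -> P p q = 0) ->
  expand mon w (- A%:Z) (- B%:Z) 0 p q = P p q.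
Proof.
move=> mE wE P0.
have [pq|/norP[pA qB]] := boolP ((p < - A%:Z) || (q < - B%:Z)).
  rewrite P0 //; apply: fsbig1 => -[s t] _ /=; rewrite mE.
  by rewrite (_ : _ && _ = false) ?scale0r //; lia.
have [s0 pE] : exists s0 : nat, p = s0%:Z - A%:Z.
  by exists (absz (p + A%:Z)); lia.
have [t0 qE] : exists t0 : nat, q = t0%:Z - B%:Z.
  by exists (absz (q + B%:Z)); lia.
rewrite /expand -(@fsbig_widen _ _ _ _ [set (s0, t0)]) //; last first.
  move=> [s t] [_ /= st]; rewrite mE (_ : _ && _ = false) ?scale0r //.
  by apply/negP => /andP[/eqP sp /eqP tq]; apply: st; congr (_, _); lia.
by rewrite fsbig_set1 mE wE -pE -qE !eqxx scale1r.
Qed.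

Lemma mon_xy0 j k p q : mon_xy j k 0 p q = ((j == p) && (k == q))%:R.
Proof.
rewrite /mon_xy binZ0 subr_eq0 addr0; have [->|kq] := eqVneq q k.
  by rewrite subrr expr0z !mulr1 andbT (inj_eq (addIr k)).
by rewrite andbF mul0r mulr0.
Qed.

Lemma mon_yx0 j k p q : mon_yx j k 0 p q = ((j == p) && (k == q))%:R.
Proof.
rewrite /mon_yx binZ0 subr_eq0 addr0; have [->|jp] := eqVneq p j.
  by rewrite subrr subr0 expr0z !mulr1 (inj_eq (addrI j)).
by rewrite mul0r mulr0.
Qed.

End Expansions.

(** * Equivalence of the Jacobi identity and rationality *)

Section Rationality.
Variables (K : numFieldType) (M : lmodType K).
Implicit Types f g h : int -> int -> M.

Lemma int_ind_step (P : int -> Prop) :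
  P 0 -> (forall n, P n <-> P (n + 1)) -> forall n, P n.
Proof.
move=> P0 PS; case=> n.
  elim: n => // n IHn; have [+ _] := PS n.
  by rewrite -PoszD addn1; exact.
elim: n => [|n IHn]; first by have [_] := PS (Negz 0); exact.
have [_] := PS (Negz n.+1); rewrite (_ : _ + 1 = Negz n); last by lia.
exact.
Qed.

Lemma borcherds_expand (w : nat -> nat -> M) a b l n m c :
  borcherds (expand (@mon_xy K) w a b l) (expand (@mon_yx K) w a b l)
    (expand (@mon_xz K) w a b l) n m c.
Proof.
have bxy w' a' b' l' := @bounded_expand_xy K M w' a' b' l'.
have byx w' a' b' l' := @bounded_expand_yx K M w' a' b' l'.
have bxz w' a' b' l' := @bounded_expand_xz K M w' a' b' l'.
(* The step in n changes l by one and negates w; for n = 0, the step in m changes b by one. This is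
   why they are generalized. The case n = m = 0 is the residue theorem. *)
move: n w b l m; apply: int_ind_step.
  move=> w b l m; move: m b; apply: int_ind_step.
    by move=> b; apply/borcherds00; exact: residue_expand.
  move=> m; split=> H b.
    by apply/borcherds_mul_snd => //; rewrite mul_snd_xy mul_snd_yx mul_add_xz.
  have /borcherds_mul_snd := H (b - 1).
  by rewrite mul_snd_xy mul_snd_yx mul_add_xz subrK; exact.
have wK (w : nat -> nat -> M) : (fun s t => - - w s t) = w.
  by apply/funext => s; apply/funext => t; rewrite opprK.
move=> n; split=> H w b l m.
  apply/borcherdsS => //; rewrite mul_ysubx_xy mul_ysubx_yx mul_snd_xz; exact: H.
have /borcherdsS := H (fun s t => - w s t) b (l - 1) m.
by rewrite mul_ysubx_xy mul_ysubx_yx mul_snd_xz subrK wK; exact.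
Qed.

Lemma bounded_snd_mul f : bounded_snd f -> bounded_snd (mul_ysubx f).
Proof.
by move=> [N fN]; exists N => p q qN; rewrite /mul_ysubx !fN ?subrr //; lia.
Qed.

Lemma bounded_fst_mul f : bounded_fst f -> bounded_fst (mul_ysubx f).
Proof.
by move=> [N fN]; exists N => p q qN; rewrite /mul_ysubx !fN ?subrr //; lia.
Qed.

Lemma bounded_snd_iter N f : bounded_snd f -> bounded_snd (iter N (@mul_ysubx K M) f).
Proof. by move=> bf; elim: N => //= N; exact: bounded_snd_mul. Qed.

Lemma bounded_fst_iter N f : bounded_fst f -> bounded_fst (iter N (@mul_ysubx K M) f).
Proof. by move=> bf; elim: N => //= N; exact: bounded_fst_mul. Qed.

(** The coefficient of x^(p+1) y^q in the product determines [f p q] from the row q - 1, and the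
    rows start at a lowest one. A bound is essential: y - x kills the sum of all x^n y^(-n-1). *)
Lemma mul_ysubx_inj_snd f f' : bounded_snd f -> bounded_snd f' ->
  mul_ysubx f = mul_ysubx f' -> f = f'.
Proof.
move=> [N fN] [N' fN'] E.
suff H (k : nat) p q : q < - (N + N')%N%:Z + k%:Z -> f p q = f' p q.
  apply/funext => p; apply/funext => q.
  by apply: (H (absz (q + (N + N')%N%:Z)).+1); lia.
elim: k p q => [|k IHk] p q qk; first by rewrite fN ?fN' //; lia.
have := congr1 (fun F => F (p + 1) q) E; rewrite /mul_ysubx addrK.
by rewrite (IHk (p + 1) (q - 1)) => [/addrI/oppr_inj|]; last lia.
Qed.

Lemma mul_ysubx_inj_fst f f' : bounded_fst f -> bounded_fst f' ->
  mul_ysubx f = mul_ysubx f' -> f = f'.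
Proof.
move=> [N fN] [N' fN'] E.
suff H (k : nat) p q : p < - (N + N')%N%:Z + k%:Z -> f p q = f' p q.
  apply/funext => p; apply/funext => q.
  by apply: (H (absz (p + (N + N')%N%:Z)).+1); lia.
elim: k p q => [|k IHk] p q pk; first by rewrite fN ?fN' //; lia.
have := congr1 (fun F => F p (q + 1)) E; rewrite /mul_ysubx addrK.
by rewrite (IHk (p - 1) (q + 1)) => [/addIr|]; last lia.
Qed.

Lemma iter_mul_ysubx_inj_snd N f f' : bounded_snd f -> bounded_snd f' ->
  iter N (@mul_ysubx K M) f = iter N (@mul_ysubx K M) f' -> f = f'.
Proof.
move=> bf bf'; elim: N => //= N IHN /mul_ysubx_inj_snd E.
by apply: IHN; apply: E; exact: bounded_snd_iter.
Qed.

Lemma iter_mul_ysubx_inj_fst N f f' : bounded_fst f -> bounded_fst f' ->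
  iter N (@mul_ysubx K M) f = iter N (@mul_ysubx K M) f' -> f = f'.
Proof.
move=> bf bf'; elim: N => //= N IHN /mul_ysubx_inj_fst E.
by apply: IHN; apply: E; exact: bounded_fst_iter.
Qed.

Lemma iter_mul_ysubx_xy N (w : nat -> nat -> M) a b l :
  iter N (@mul_ysubx K M) (expand (@mon_xy K) w a b l)
  = expand (@mon_xy K) (fun s t => (-1) ^+ N *: w s t) a b (l + N%:Z).
Proof.
elim: N => [|N IHN].
  rewrite (_ : (fun s t => _) = w) ?addr0 //.
  by apply/funext => s; apply/funext => t; rewrite scale1r.
rewrite iterS IHN mul_ysubx_xy -addrA -PoszD addn1.
rewrite (_ : (fun s t => - _) = fun s t => (-1) ^+ N.+1 *: w s t) //.
by apply/funext => s; apply/funext => t; rewrite exprS mulN1r scaleNr.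
Qed.

Lemma iter_mul_ysubx_yx N (w : nat -> nat -> M) a b l :
  iter N (@mul_ysubx K M) (expand (@mon_yx K) w a b l)
  = expand (@mon_yx K) (fun s t => (-1) ^+ N *: w s t) a b (l + N%:Z).
Proof.
elim: N => [|N IHN].
  rewrite (_ : (fun s t => _) = w) ?addr0 //.
  by apply/funext => s; apply/funext => t; rewrite scale1r.
rewrite iterS IHN mul_ysubx_yx -addrA -PoszD addn1.
rewrite (_ : (fun s t => - _) = fun s t => (-1) ^+ N.+1 *: w s t) //.
by apply/funext => s; apply/funext => t; rewrite exprS mulN1r scaleNr.
Qed.

Lemma borcherds_iter N f g h n m b : bounded_snd f -> bounded_fst g ->
  borcherds f g h (n + N%:Z) m b <->
  borcherds (iter N (@mul_ysubx K M) f) (iter N (@mul_ysubx K M) g)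
    (iter N (@mul_snd K M) h) n m b.
Proof.
move=> bf bg; elim: N n => [|N IHN] n; first by rewrite addr0.
rewrite -addn1 PoszD [N%:Z + 1]addrC addrA addn1 /=.
rewrite IHN; apply: borcherdsS; [exact: bounded_snd_iter|exact: bounded_fst_iter].
Qed.

Lemma jac_yx0 g m b : jac_yx g 0 m b = g b (- m - 1).
Proof.
rewrite /jac_yx (fsbig_pred1 (n := 0%N)); last first.
  by move=> i i0; rewrite binz0 (negbTE i0) scale0r.
by rewrite binz0 expr0 !scale1r !subr0 ?addr0.
Qed.

Lemma jac_xy0 f m b : jac_xy f 0 m b = f b (- m - 1).
Proof.
rewrite /jac_xy (fsbig_pred1 (n := 0%N)); last first.
  by move=> i i0; rewrite binz0 (negbTE i0) scale0r.
by rewrite binz0 expr0z expr0 !scale1r !subr0 ?addr0.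
Qed.

Lemma jac_xz0 h n b : jac_xz h n 0 b = h b (- n - 1).
Proof.
rewrite /jac_xz (fsbig_pred1 (n := 0%N)); last first.
  by move=> i i0; rewrite binz0 (negbTE i0) scale0r.
by rewrite binz0 scale1r !subr0 ?addr0.
Qed.

Lemma iter_mul_snd N h p q : iter N (@mul_snd K M) h p q = h p (q - N%:Z).
Proof.
elim: N q => [|N IHN] q /=; first by rewrite subr0.
rewrite /mul_snd IHN; congr h; lia.
Qed.

(* If h has a pole of order at most N at y = x, the Jacobi identity with n = N
   says that (y - x)^N f = (y - x)^N g.  This common value has bounded poles in
   both x and y, so that it is the numerator of the fraction sought.  As any
   fraction satisfies the Jacobi identity, which for m = 0 expresses h through
   f and g, the third expansion needs no further argument. *)
Lemma borcherds_rational f g h :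
  bounded_snd f -> bounded_fst g -> bounded_snd h ->
  (forall n m b, borcherds f g h n m b) <->
  exists F : loc_series M, let ex mon :=
      expand mon (lf_num F) (- (lf_x F)%:Z) (- (lf_y F)%:Z) (- (lf_xy F)%:Z) in
    [/\ ex (@mon_xy K) = f, ex (@mon_yx K) = g & ex (@mon_xz K) = h].
Proof.
move=> bf bg bh; split; last first.
  by move=> [F /= [<- <- <-]] n m b; exact: borcherds_expand.
move=> J; have [B fB] := bf; have [A gA] := bg; have [N hN] := bh.
set P := iter N (@mul_ysubx K M) f.
have PE : P = iter N (@mul_ysubx K M) g.
  apply/funext => b; apply/funext => q.
  (* The choice m = -q-1 selects the coefficient of y^q. On the right, the exponents of y - x are at
     most -N-1, where h vanishes. *)
  have := J (0 + N%:Z) (- q - 1) b => /borcherds_iter.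
  move=> /(_ bf bg); rewrite /borcherds jac_yx0 jac_xy0.
  rewrite (_ : - (- q - 1) - 1 = q); last by lia.
  rewrite [RHS]fsbig1 => [/eqP|i _].
    by rewrite subr_eq0 => /eqP ->.
  by rewrite iter_mul_snd hN ?scaler0 //; lia.
(* Multiplication by y - x lowers no exponent, so P inherits the bound of f in y and that of g in
   x. *)
have Pf p q : q < - B%:Z -> P p q = 0.
  have H (k : nat) : forall p q, q < - B%:Z -> iter k (@mul_ysubx K M) f p q = 0.
    elim: k => //= k IHk p' q' qB.
    by rewrite /mul_ysubx !IHk ?subrr //; lia.
  exact: H.
have Pg p q : p < - A%:Z -> P p q = 0.
  have H (k : nat) : forall p q, p < - A%:Z -> iter k (@mul_ysubx K M) g p q = 0.
    elim: k => //= k IHk p' q' qB.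
    by rewrite /mul_ysubx !IHk ?subrr //; lia.
  by rewrite PE; exact: H.
have P0 (p q : int) : (p < - A%:Z) || (q < - B%:Z) -> P p q = 0.
  by case/orP => [/Pg|/Pf].
(* The sign is there because P is (y - x)^N f while the denominator of the fraction is (x - y)^N. *)
pose w (s t : nat) := (-1) ^+ N *: P (s%:Z - A%:Z) (t%:Z - B%:Z).
have wE s t : (-1) ^+ N *: w s t = P (s%:Z - A%:Z) (t%:Z - B%:Z).
  by rewrite scalerA -expr2 sqrr_sign scale1r.
have fE : expand (@mon_xy K) w (- A%:Z) (- B%:Z) (- N%:Z) = f.
  apply: (@iter_mul_ysubx_inj_snd N) => //; first exact: bounded_expand_xy.
  rewrite iter_mul_ysubx_xy addNr -/P; apply/funext => p; apply/funext => q.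
  by apply: expand_mon0 => // j k; exact: mon_xy0.
have gE : expand (@mon_yx K) w (- A%:Z) (- B%:Z) (- N%:Z) = g.
  apply: (@iter_mul_ysubx_inj_fst N) => //; first exact: bounded_expand_yx.
  rewrite iter_mul_ysubx_yx addNr -PE; apply/funext => p; apply/funext => q.
  by apply: expand_mon0 => // j k; exact: mon_yx0.
exists (LocSeries w A B N); split=> //=.
apply/funext => b; apply/funext => q.
have := J (- q - 1) 0 b.
have := borcherds_expand w (- A%:Z) (- B%:Z) (- N%:Z) (- q - 1) 0 b.
rewrite fE gE /borcherds !jac_xz0 (_ : - (- q - 1) - 1 = q); last by lia.
by move=> -> ->.
Qed.

End Rationality.

(** * From exponents in [K] to integer exponents *)

Section CoefficientExtraction.
Variable K : numFieldType.

Lemma monomial_sum1 (E : Type) (J : choiceType) (c : J -> K) (d : J -> E) (j : J) :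
  injective d -> monomial_sum c d (d j) = c j.
Proof.
move=> dI; rewrite /monomial_sum (_ : [set k | d k = d j] = [set j]) ?fsbig_set1 //.
by apply/seteqP; split=> k /=; [exact: dI|move=> ->].
Qed.

Lemma monomial_sum0 (E : Type) (J : choiceType) (c : J -> K) (d : J -> E) (e : E) :
  (forall j, d j <> e) -> monomial_sum c d e = 0.
Proof.
move=> de; rewrite /monomial_sum (_ : [set k | d k = e] = set0) ?fsbig_set0 //.
by apply/seteqP; split=> k //= /de.
Qed.

(** A common form for the three monomial expansions: b is the condition on the total degree, i0 the
    only index that can contribute, and s extends c by 0 to negative indices. *)
Lemma monomial_sum_int (c : nat -> K) (s : int -> K) (i0 j0 p q : int) (b : bool) :
  (forall i : nat, s i%:Z = c i) -> (forall i : nat, s (Negz i) = 0) ->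
  forall d : nat -> K * K, injective d ->
  (forall i : nat, d i = (p%:~R, q%:~R) <-> b /\ i%:Z = i0) ->
  monomial_sum c d (p%:~R, q%:~R) = b%:R * s i0.
Proof.
move=> sc sN d dI dE; case: b dE => dE; last first.
  by rewrite mul0r monomial_sum0 // => j /dE [].
rewrite mul1r; case: i0 dE => i0 dE; last first.
  by rewrite sN monomial_sum0 // => j /dE [].
have <- : d i0 = (p%:~R, q%:~R) by apply/dE.
by rewrite monomial_sum1 // sc.
Qed.

Lemma iota_xy_monomialE (j k l p q : int) :
  @iota_xy_monomial K j k l (p%:~R, q%:~R) = @mon_xy K j k l p q.
Proof.
apply: (monomial_sum_int (s := fun i => binZ K l i * (-1) ^ i)) => //.
- by move=> i; rewrite /= mul0r.
- by move=> i i' [_ /intr_inj]; lia.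
- move=> i; split=> [[/intr_inj ip /intr_inj iq]|[/eqP e iq]].
    by split; [apply/eqP|]; lia.
  by congr (_%:~R, _%:~R); lia.
Qed.

Lemma iota_yx_monomialE (j k l p q : int) :
  @iota_yx_monomial K j k l (p%:~R, q%:~R) = @mon_yx K j k l p q.
Proof.
apply: (monomial_sum_int (s := fun i => binZ K l i * (-1) ^ (l - i))) => //.
- by move=> i; rewrite /= mul0r.
- by move=> i i' [/intr_inj]; lia.
- move=> i; split=> [[/intr_inj ip /intr_inj iq]|[/eqP e iq]].
    by split; [apply/eqP|]; lia.
  by congr (_%:~R, _%:~R); lia.
Qed.

Lemma iota_x_yx_monomialE (j k l p q : int) :
  @iota_x_yx_monomial K j k l (p%:~R, q%:~R) = @mon_xz K j k l p q.
Proof.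
apply: (monomial_sum_int (s := fun i => binZ K k i * (-1) ^ l)) => //.
- by move=> i; rewrite /= mul0r.
- by move=> i i' [_ /intr_inj]; lia.
- move=> i; split=> [[/intr_inj ip /intr_inj iq]|[/eqP e iq]].
    by split; [apply/eqP|]; lia.
  by congr (_%:~R, _%:~R); lia.
Qed.

Definition is_int (x : K) : Prop := exists n : int, x = n%:~R.

Lemma is_intN x : is_int x -> is_int (- x).
Proof. by move=> [n ->]; exists (- n); rewrite rmorphN. Qed.

Lemma is_intD x y : is_int x -> is_int y -> is_int (x + y).
Proof. by move=> [n ->] [m ->]; exists (n + m); rewrite rmorphD. Qed.

Lemma is_intB x y : is_int x -> is_int y -> is_int (x - y).
Proof. by move=> xi yi; apply: is_intD => //; exact: is_intN. Qed.

Lemma is_int_int (n : int) : is_int n%:~R.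
Proof. by exists n. Qed.

Lemma is_int_nat (n : nat) : is_int n%:R.
Proof. by exists n%:Z. Qed.

Variable M : lmodType K.

(** Both series vanish unless both exponents are integers, so comparing integer coefficients
    suffices. *)
Lemma series2_eq (mon : int -> int -> int -> K * K -> K)
    (imon : int -> int -> int -> int -> int -> K) (F : loc_series M) (f : K * K -> M) :
  (forall j k l p q, mon j k l (p%:~R, q%:~R) = imon j k l p q) ->
  (forall j k l x y, ~ (is_int x /\ is_int y) -> mon j k l (x, y) = 0) ->
  (forall x y, ~ (is_int x /\ is_int y) -> f (x, y) = 0) ->
  iota_extend mon F = f <->
  expand imon (lf_num F) (- (lf_x F)%:Z) (- (lf_y F)%:Z) (- (lf_xy F)%:Z)
  = fun p q => f (p%:~R, q%:~R).
Proof.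
move=> monE mon0 f0.
have iotaE p q : iota_extend mon F (p%:~R, q%:~R)
    = expand imon (lf_num F) (- (lf_x F)%:Z) (- (lf_y F)%:Z) (- (lf_xy F)%:Z) p q.
  by apply: eq_fsbigr => -[s t] _ /=; rewrite monE.
split=> [<-|E].
  by apply/funext => p; apply/funext => q; rewrite iotaE.
apply/funext => -[x y].
have [[[p ->] [q ->]]|nxy] := pselect (is_int x /\ is_int y).
  by rewrite iotaE E.
by rewrite f0 //; apply: fsbig1 => -[s t] _ /=; rewrite mon0 // scale0r.
Qed.

Lemma rational_iotaP (f g h : K * K -> M) :
  (forall x y, ~ (is_int x /\ is_int y) -> f (x, y) = 0) ->
  (forall x y, ~ (is_int x /\ is_int y) -> g (x, y) = 0) ->
  (forall x y, ~ (is_int x /\ is_int y) -> h (x, y) = 0) ->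
  (exists F : loc_series M, [/\ iota_xy F = f, iota_yx F = g & iota_x_yx F = h])
  <->
  exists F : loc_series M, let ex mon :=
      expand mon (lf_num F) (- (lf_x F)%:Z) (- (lf_y F)%:Z) (- (lf_xy F)%:Z) in
    [/\ ex (@mon_xy K) = fun p q => f (p%:~R, q%:~R),
        ex (@mon_yx K) = fun p q => g (p%:~R, q%:~R)
      & ex (@mon_xz K) = fun p q => h (p%:~R, q%:~R)].
Proof.
move=> f0 g0 h0.
have ne (x y : K) (p q : int) : ~ (is_int x /\ is_int y) -> (p%:~R, q%:~R) <> (x, y).
  by move=> nxy [xp yq]; apply: nxy; rewrite -xp -yq; split; exact: is_int_int.
have Ef F := @series2_eq _ _ F f iota_xy_monomialE
  (fun j k l x y nxy => monomial_sum0 _ (fun i => @ne x y _ _ nxy)) f0.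
have Eg F := @series2_eq _ _ F g iota_yx_monomialE
  (fun j k l x y nxy => monomial_sum0 _ (fun i => @ne x y _ _ nxy)) g0.
have Eh F := @series2_eq _ _ F h iota_x_yx_monomialE
  (fun j k l x y nxy => monomial_sum0 _ (fun i => @ne x y _ _ nxy)) h0.
by split=> -[F [/Ef Ff /Eg Fg /Eh Fh]]; exists F.
Qed.

End CoefficientExtraction.

(** * The Jacobi identity of I and the rationality of x^c I *)

Section JacobiIdentity.
Variables (K : numFieldType) (V W1 W2 W3 : lmodType K).
Variables (Y1 : V -> W1 -> K -> W1) (Y2 : V -> W2 -> K -> W2)
  (Y3 : V -> W3 -> K -> W3).
Hypotheses (Y1L : forall a u, laurent (Y1 a u)) (Y2L : forall a u, laurent (Y2 a u))
  (Y3L : forall a u, laurent (Y3 a u)) (Y3B : bilinear_map Y3).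

Lemma laurent_int (M : lmodType K) (f : K -> M) (x : K) :
  laurent f -> ~ is_int x -> f x = 0.
Proof.
move=> [N fN] nx; apply: contrapT => /fN [n _ xn].
by apply: nx; exists n.
Qed.

Lemma laurent_lt (M : lmodType K) (f : K -> M) : laurent f ->
  exists N : nat, forall n : int, n < - N%:Z -> f n%:~R = 0.
Proof.
move=> [N fN]; exists `|N|%N => n nN; apply: contrapT => /fN [m Nm /intr_inj].
lia.
Qed.

Variables (I : W1 -> W2 -> K -> W3) (c : K).
Hypotheses (IB : bilinear_map I) (IL : forall u v, laurent (xpow_mul c (I u v))).

Lemma bilinear_0r (A B C : lmodType K) (f : A -> B -> C) u : bilinear_map f -> f u 0 = 0.
Proof. by move=> [fl _]; exact: linear_fun0 (fl u). Qed.

Lemma bilinear_0l (A B C : lmodType K) (f : A -> B -> C) u : bilinear_map f -> f 0 u = 0.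
Proof. by move=> [_ fl]; exact: linear_fun0 (fl u). Qed.

(** The shift by c makes p the exponent of x in x^c I, which runs over the integers. *)
Definition coef_IY a u v (p q : int) : W3 := I u (Y2 a v q%:~R) (p%:~R - c).

Definition coef_YI a u v (p q : int) : W3 := Y3 a (I u v (p%:~R - c)) q%:~R.

Definition coef_IYu a u v (p q : int) : W3 := I (Y1 a u q%:~R) v (p%:~R - c).

Lemma I_shift_int u v x : ~ is_int (x + c) -> I u v x = 0.
Proof.
by move=> /(laurent_int (IL u v)); rewrite /xpow_mul addrK.
Qed.

Lemma bounded_coef_IY a u v : bounded_snd (coef_IY a u v).
Proof.
have [N YN] := laurent_lt (Y2L a v); exists N => p q /YN.
by rewrite /coef_IY => ->; rewrite (bilinear_0r _ IB).
Qed.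

Lemma bounded_coef_YI a u v : bounded_fst (coef_YI a u v).
Proof.
have [N IN] := laurent_lt (IL u v); exists N => p q /IN.
by rewrite /coef_YI /xpow_mul => ->; rewrite (bilinear_0r _ Y3B).
Qed.

Lemma bounded_coef_IYu a u v : bounded_snd (coef_IYu a u v).
Proof.
have [N YN] := laurent_lt (Y1L a u); exists N => p q /YN.
by rewrite /coef_IYu => ->; rewrite (bilinear_0l _ IB).
Qed.

Lemma borcherds_coef a u v (n m b : int) :
  borcherds (coef_IY a u v) (coef_YI a u v) (coef_IYu a u v) n m b <->
  let beta := b%:~R - c in
  \sum_(i \in [set: nat]) (binz K n i * (-1) ^+ i) *:
     Y3 a (I u v (beta - i%:R)) (- m%:~R - 1 - (n%:~R - i%:R))
  - \sum_(i \in [set: nat]) ((-1) ^ n * (binz K n i * (-1) ^+ i)) *: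
     I u (Y2 a v (- m%:~R - 1 - i%:R)) (beta - (n%:~R - i%:R))
  = \sum_(i \in [set: nat]) binz K m i *:
     I (Y1 a u (- n%:~R - 1 - i%:R)) v (beta - (m%:~R - i%:R)).
Proof.
rewrite /borcherds /=.
have -> : jac_yx (coef_YI a u v) n m b
  = \sum_(i \in [set: nat]) (binz K n i * (-1) ^+ i) *:
     Y3 a (I u v (b%:~R - c - i%:R)) (- m%:~R - 1 - (n%:~R - i%:R)).
  apply: eq_fsbigr => i _; rewrite scalerA /coef_YI; congr (_ *: Y3 a (I u v _) _).
    by rewrite rmorphB /=; ring.
  by rewrite rmorphD !rmorphB rmorphN /=; ring.
have -> : jac_xy (coef_IY a u v) n m b
  = \sum_(i \in [set: nat]) ((-1) ^ n * (binz K n i * (-1) ^+ i)) *: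
     I u (Y2 a v (- m%:~R - 1 - i%:R)) (b%:~R - c - (n%:~R - i%:R)).
  apply: eq_fsbigr => i _; rewrite !scalerA /coef_IY.
  congr (_ *: I u (Y2 a v _) _).
  - by rewrite mulrA; congr (_ * _); rewrite mulrC.
  - by rewrite !rmorphB rmorphN /=; ring.
  - by rewrite rmorphD !rmorphB /=; ring.
have -> // : jac_xz (coef_IYu a u v) n m b
  = \sum_(i \in [set: nat]) binz K m i *:
     I (Y1 a u (- n%:~R - 1 - i%:R)) v (b%:~R - c - (m%:~R - i%:R)).
apply: eq_fsbigr => i _; rewrite /coef_IYu.
congr (_ *: I (Y1 a u _) v _).
- by rewrite !rmorphB rmorphN /=; ring.
- by rewrite rmorphD !rmorphB /=; ring.
Qed.

(** The exponents (-n-1, -m-1, b-c) are the only ones that matter: if [e0] or [e1] is not an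
    integer, or [e2] is not in Z - c, every term vanishes, either by the support of a delta function
    or by the Laurent property. *)
Lemma jacobi_borcherds : jacobi_identity Y1 Y2 Y3 I <->
  forall a u v n m b,
    borcherds (coef_IY a u v) (coef_YI a u v) (coef_IYu a u v) n m b.
Proof.
split=> [J a u v n m b|J a u v [[e0 e1] e2] /=].
  by apply/borcherds_coef; exact (jacobi_coef J a u v n m (b%:~R - c)).
rewrite !series_mul_monomial; first last.
- move=> [n i] [m j] [/addIr /oppr_inj /intr_inj -> _ /eqP].
  by rewrite eqr_nat => /eqP ->.
- move=> [n i] [m j] [/addIr /oppr_inj /intr_inj -> /eqP + _].
  by rewrite eqr_nat => /eqP ->.
- move=> [n i] [m j] [/eqP + /addIr /oppr_inj /intr_inj -> _].
  by rewrite eqr_nat => /eqP ->.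
have intE (x : K) : is_int x -> exists n : int, x = - n%:~R - 1.
  by move=> [n ->]; exists (- n - 1); rewrite rmorphB rmorphN /=; ring.
have eq_int (x : K) (n : int) : x - (- n%:~R - 1) == 0 -> is_int x.
  rewrite subr_eq0 => /eqP ->; exists (- n - 1); by rewrite rmorphB rmorphN.
have sub_int (x y : K) : is_int y -> ~ is_int x -> ~ is_int (x - y).
  by move=> yi xi xyi; apply: xi; rewrite -[x](subrK y); exact: is_intD.
have ni (n : int) (i : nat) : is_int (n%:~R - i%:R : K).
  by apply: is_intB; [exact: is_int_int|exact: is_int_nat].
have [|e0i] := pselect (is_int e0); last first.
  rewrite !fsbig1 ?subrr // => -[n i] _ /=.
  - rewrite (laurent_int (Y1L a u)); last exact: sub_int (is_int_nat K i) e0i.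
    by rewrite (bilinear_0l _ IB); case: ifP => _; rewrite scaler0.
  - by case: ifP => [/eq_int //|_]; rewrite scaler0.
  - by case: ifP => [/eq_int //|_]; rewrite scaler0.
move=> /intE [n ->] {e0}.
have [|e1i] := pselect (is_int e1); last first.
  rewrite !fsbig1 ?subrr // => -[m i] _ /=.
  - by case: ifP => [/eq_int //|_]; rewrite scaler0.
  - rewrite (laurent_int (Y2L a v)); last exact: sub_int (is_int_nat K i) e1i.
    by rewrite (bilinear_0r _ IB); case: ifP => _; rewrite scaler0.
  - rewrite (laurent_int (Y3L a _)); last exact: sub_int (ni m i) e1i.
    by case: ifP => _; rewrite scaler0.
move=> /intE [m ->] {e1}.
have [|e2i] := pselect (is_int (e2 + c)); last first.
  have I0 u' v' x : is_int x -> I u' v' (e2 - x) = 0.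
    by move=> xi; apply: I_shift_int; rewrite addrAC; exact: sub_int.
  rewrite !fsbig1 ?subrr // => -[k i] _ /=.
  - by rewrite I0 //; case: ifP => _; rewrite scaler0.
  - by rewrite I0 //; case: ifP => _; rewrite scaler0.
  - rewrite I0; last exact: is_int_nat.
    by rewrite (bilinear_0r _ Y3B); case: ifP => _; rewrite scaler0.
move=> [b /(canRL (addrK _)) ->] {e2}.
have dlt (x y : int) : x != y -> (- y%:~R - 1 - (- x%:~R - 1) == 0 :> K) = false.
  move=> xy; apply: contraNF xy; rewrite subr_eq0 => /eqP /addIr /oppr_inj /intr_inj -> //.
rewrite (fsbig_pair_fst (n := n)); last by move=> x i xn; rewrite /= dlt // scaler0.
rewrite (fsbig_pair_fst (n := n)); last by move=> x i xn; rewrite /= dlt // scaler0.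
rewrite (fsbig_pair_fst (n := m)); last by move=> x i xn; rewrite /= dlt // scaler0.
by rewrite /= !subrr !eqxx; have /borcherds_coef := J a u v n m b.
Qed.

(** The factor x^c merely relabels the exponents of x, so [borcherds_rational] applies to the
    integer coefficients for each a, u, v. *)
Lemma jacobi_rational : jacobi_identity Y1 Y2 Y3 I <->
  forall u v a, exists F : loc_series W3,
    [/\ iota_xy F = (fun e : K * K => let '(ex, ey) := e in
           xpow_mul c (I u (Y2 a v ey)) ex),
        iota_yx F = (fun e : K * K => let '(ex, ey) := e in
           Y3 a (xpow_mul c (I u v) ex) ey)
      & iota_x_yx F = (fun e : K * K => let '(ex, eyx) := e in
           xpow_mul c (I (Y1 a u eyx) v) ex)].
Proof.
have H a u v := borcherds_rational (bounded_coef_IY a u v) (bounded_coef_YI a u v)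
  (bounded_coef_IYu a u v).
have f0 a u v x y : ~ (is_int x /\ is_int y) -> xpow_mul c (I u (Y2 a v y)) x = 0.
  move=> /not_andP[xi|yi]; first by rewrite (laurent_int (IL _ _)).
  by rewrite /xpow_mul (laurent_int (Y2L _ _)) // (bilinear_0r _ IB).
have g0 a u v x y : ~ (is_int x /\ is_int y) -> Y3 a (xpow_mul c (I u v) x) y = 0.
  move=> /not_andP[xi|yi]; last by rewrite (laurent_int (Y3L _ _)).
  by rewrite (laurent_int (IL _ _)) // (bilinear_0r _ Y3B).
have h0 a u v x y : ~ (is_int x /\ is_int y) -> xpow_mul c (I (Y1 a u y) v) x = 0.
  move=> /not_andP[xi|yi]; first by rewrite (laurent_int (IL _ _)).
  by rewrite /xpow_mul (laurent_int (Y1L _ _)) // (bilinear_0l _ IB).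
have L u v a := @rational_iotaP K W3
   (fun e : K * K => let '(ex, ey) := e in xpow_mul c (I u (Y2 a v ey)) ex)
   (fun e : K * K => let '(ex, ey) := e in Y3 a (xpow_mul c (I u v) ex) ey)
   (fun e : K * K => let '(ex, eyx) := e in xpow_mul c (I (Y1 a u eyx) v) ex)
   (f0 a u v) (g0 a u v) (h0 a u v).
rewrite jacobi_borcherds; split=> [J u v a|J a u v].
  by apply/L/H; exact: J.
by apply/H/L; exact: J.
Qed.



End JacobiIdentity.

(** * Weights of the coefficients and the derivative property *)

Section Weights.
Variables (K : numFieldType) (V : voa K).

Lemma direct_sum_ind (M : lmodType K) (J : choiceType) (F : J -> set M) (P : M -> Prop) :
  direct_sum F -> P 0 -> (forall u v, P u -> P v -> P (u + v)) ->
  (forall j w, F j w -> P w) -> forall w, P w.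
Proof.
move=> [_ dF] P0 PD PF w; have [f [[ff fF ->] _]] := dF w.
by apply: (big_ind P) => // j _; apply: PF.
Qed.

Variables (W1 W2 W3 : weak_module V) (I : W1 -> W2 -> K -> W3).
Hypotheses (IB : bilinear_map I)
  (J : jacobi_identity (modY W1) (modY W2) (modY W3) I).

Let L0_1 := Lmode (modY W1) (omega V) 0.
Let L0_2 := Lmode (modY W2) (omega V) 0.
Let L0_3 := Lmode (modY W3) (omega V) 0.
Let L_1 := Lmode (modY W1) (omega V) (-1).

Lemma L0_intertwining u v beta :
  L0_3 (I u v beta) - I u (L0_2 v) beta
  = I (L_1 u) v (beta - 1) + I (L0_1 u) v beta.
Proof.
(* With n = 0 and m = 1 the left side is the commutator with omega_1 = L(0); on the right only i = 0
   and i = 1 survive, giving omega_0 = L(-1) and omega_1 = L(0). *)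
have := jacobi_coef J (omega V) u v 0 1 beta.
rewrite [X in X - _](fsbig_pred1 (n := 0%N)); last first.
  by move=> i i0; rewrite binz0 (negbTE i0) mul0r scale0r.
rewrite [X in _ - X](fsbig_pred1 (n := 0%N)); last first.
  by move=> i i0; rewrite binz0 (negbTE i0) mul0r mulr0 scale0r.
rewrite fsbig_pred2; last first.
  by move=> i i2; rewrite binz1 ltnNge i2 scale0r.
rewrite !binz0 !binz1 /= !expr0 expr0z !mulr1 !scale1r !subr0 subrr subr0.
have -> : - 0%:~R - 1 = - (-1 + 1)%:~R - 1 :> K by rewrite addNr.
have -> : - (-1 + 1)%:~R - 1 - 1 = - (0 + 1)%:~R - 1 :> K by rewrite addNr oppr0 add0r.
exact.
Qed.

Lemma bilinear_coefZl mu u v beta : I (mu *: u) v beta = mu *: I u v beta.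
Proof. by have /(congr1 (@^~ beta)) := linear_funZ mu u (IB.2 v). Qed.

Lemma bilinear_coefZr mu u v beta : I u (mu *: v) beta = mu *: I u v beta.
Proof. by have /(congr1 (@^~ beta)) := linear_funZ mu v (IB.1 u). Qed.

(** In [L0_intertwining] the derivative contributes beta times the coefficient, which adds beta to
    the two weights. *)
Lemma weight_intertwining u v mu1 mu2 beta :
  (forall u v, I (L_1 u) v = derivative (I u v)) ->
  L0_eigenspace W1 mu1 u -> L0_eigenspace W2 mu2 v ->
  L0_eigenspace W3 (mu1 + mu2 + beta) (I u v beta).
Proof.
move=> ID u1 v2; have := L0_intertwining u v beta.
rewrite ID (_ : L0_1 u = mu1 *: u) // (_ : L0_2 v = mu2 *: v) //.
rewrite bilinear_coefZl bilinear_coefZr /derivative subrK.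
move=> /(canRL (subrK _)) E.
rewrite /L0_eigenspace /eigenspace_of /= -/L0_3 [LHS]E -!scalerDl.
by congr (_ *: _); ring.
Qed.

(** The same commutator formula at beta + 1, solved for the L(-1) term; a single coefficient of
    known weight is enough. *)
Lemma derivative_of_weights u v mu1 mu2 beta :
  L0_eigenspace W1 mu1 u -> L0_eigenspace W2 mu2 v ->
  L0_eigenspace W3 (mu1 + mu2 + (beta + 1)) (I u v (beta + 1)) ->
  I (L_1 u) v beta = derivative (I u v) beta.
Proof.
move=> u1 v2 w3; have := L0_intertwining u v (beta + 1).
rewrite (_ : L0_1 u = mu1 *: u) // (_ : L0_2 v = mu2 *: v) //.
rewrite (_ : L0_3 _ = (mu1 + mu2 + (beta + 1)) *: I u v (beta + 1)) //.
rewrite bilinear_coefZl bilinear_coefZr addrK /derivative.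
move=> /esym/(canRL (addrK _)) ->; rewrite -!scalerBl.
by congr (_ *: _); ring.
Qed.

End Weights.

(** * Closure of Laurent series and transport of subspaces *)

Section Laurent.
Variables (K : numFieldType) (M : lmodType K).

Lemma laurent0 : laurent (0 : K -> M).
Proof. by exists 0. Qed.

Lemma laurent_linear (f : K -> M) (c : K) (g : K -> M) :
  laurent f -> laurent g -> laurent (c *: f + g).
Proof.
move=> [N fN] [N' gN]; exists (Num.min N N') => x.
have [fx|/fN [n Nn ->] _] := pselect (f x = 0); last first.
  by exists n => //; rewrite ge_min Nn.
rewrite -[(_ + _) x]/(c *: f x + g x) fx scaler0 add0r => /gN [n Nn ->].
by exists n => //; rewrite ge_min Nn orbT.
Qed.

End Laurent.

(** This transports the subspace property to the Z-graded operators, which avoids combining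
    fractions with different denominators. *)
Lemma subspace_image (K : numFieldType) (M N : lmodType K) (A : set M) (B : set N)
    (f : M -> N) :
  subspace A -> f 0 = 0 -> (forall (c : K) u v, f (c *: u + v) = c *: f u + f v) ->
  set_bij A B f -> subspace B.
Proof.
move=> [A0 AD] f0 fl [fAB _ fS]; split; first by rewrite -f0; exact: fAB.
move=> c u v /fS [u' Au' <-] /fS [v' Av' <-]; rewrite -fl; apply: fAB; exact: AD.
Qed.

(** * The two directions of the correspondence *)

Section GradedIntertwiningOperators.
Variables (K : numFieldType) (V : voa K) (W1 W2 W3 : voa_module V).
Variables lambda1 lambda2 lambda3 : K.
Hypotheses (dW1 : direct_sum (fun j : nat => L0_eigenspace W1 (lambda1 + j%:R)))
  (dW2 : direct_sum (fun j : nat => L0_eigenspace W2 (lambda2 + j%:R)))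
  (dW3 : direct_sum (fun j : nat => L0_eigenspace W3 (lambda3 + j%:R))).

Let c := lambda1 + lambda2 - lambda3.

Lemma L0_eigenspace_eq0 (nu : K) (w : W3) :
  L0_eigenspace W3 nu w -> (forall j : nat, lambda3 + j%:R != nu) -> w = 0.
Proof.
move=> wnu ne.
apply: (direct_sum_eigenvector (L := Lmode (modY W3) (omega V) 0)
   (mu := fun j : nat => lambda3 + j%:R) _ dW3 _ ne wnu) => //.
by move=> k u v; have [blV _] := modY_bilinear W3; rewrite /Lmode /mode blV.
Qed.

(** For negative n both sides mean w = 0, as the weights of [W3] lie in lambda3 + N. *)
Lemma extend_grading_L0 (n : int) (w : W3) :
  extend_grading (fun j : nat => L0_eigenspace W3 (lambda3 + j%:R)) n w
  <-> L0_eigenspace W3 (lambda3 + n%:~R) w.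
Proof.
case: n => [n|n] //=; split=> [->|wn].
  rewrite /L0_eigenspace /eigenspace_of /= scaler0.
  by have [blV _] := modY_bilinear W3; rewrite /Lmode /mode linear_fun0.
apply: L0_eigenspace_eq0 wn _ => j.
by rewrite (inj_eq (addrI _)) -[j%:R]/(j%:Z%:~R) eqr_int.
Qed.

Variable I : W1 -> W2 -> K -> W3.
Hypothesis (IB : bilinear_map I).

Lemma laurent_of_homogeneous :
  (forall (i j : nat) u v, L0_eigenspace W1 (lambda1 + i%:R) u ->
     L0_eigenspace W2 (lambda2 + j%:R) v -> laurent (xpow_mul c (I u v))) ->
  forall u v, laurent (xpow_mul c (I u v)).
Proof.
move=> H u v; move: u; apply: (direct_sum_ind dW1).
- by rewrite (bilinear_0l _ IB); exact: laurent0.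
- move=> u u' Lu Lu'; have := laurent_linear 1 Lu Lu'.
  have := IB.2 v 1 u u'; rewrite /= !scale1r => -> //.
move=> i u ui; move: v; apply: (direct_sum_ind dW2).
- by rewrite (bilinear_0r _ IB); exact: laurent0.
- move=> v v' Lv Lv'; have := laurent_linear 1 Lv Lv'.
  have := IB.1 u 1 v v'; rewrite /= !scale1r => -> //.
- by move=> j v vj; exact: H ui vj.
Qed.

Lemma bilinear_xpow_mul (d : K) (A B C : lmodType K) (f : A -> B -> K -> C) :
  bilinear_map f -> bilinear_map (fun u v => xpow_mul d (f u v)).
Proof.
by move=> [fr fl]; split=> [u k v v'|v k u u']; [rewrite fr|rewrite /= fl].
Qed.

Lemma xpow_mulK (d : K) (C : lmodType K) (f : K -> C) : xpow_mul d (xpow_mul (- d) f) = f.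
Proof. by apply/funext => x; rewrite /xpow_mul opprK subrK. Qed.

Lemma xpow_mulNK (d : K) (C : lmodType K) (f : K -> C) : xpow_mul (- d) (xpow_mul d f) = f.
Proof. by apply/funext => x; rewrite /xpow_mul opprK addrK. Qed.

(** The shift by c replaces lambda1 + lambda2 by lambda3 in the weight. *)
Lemma intertwining_weight (i j : nat) u v x :
  intertwining_op W1 W2 W3 I ->
  L0_eigenspace W1 (lambda1 + i%:R) u -> L0_eigenspace W2 (lambda2 + j%:R) v ->
  L0_eigenspace W3 (lambda3 + (i%:R + j%:R + x)) (xpow_mul c (I u v) x).
Proof.
move=> [_ _ J D] ui vj; rewrite /xpow_mul.
rewrite (_ : lambda3 + _ = lambda1 + i%:R + (lambda2 + j%:R) + (x - c)).
  exact: weight_intertwining.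
by rewrite /c; ring.
Qed.

Lemma intertwining_laurent u v :
  intertwining_op W1 W2 W3 I -> laurent (xpow_mul c (I u v)).
Proof.
move=> intI; move: u v; apply: laurent_of_homogeneous => i j u v ui vj.
(* A nonzero coefficient has weight lambda3 + k with k natural and k = i + j + x, hence x is an
   integer at least -(i+j). *)
exists (- (i + j)%N%:Z) => x nz.
have [[k kE]|nk] := pselect (exists k : nat, k%:R = i%:R + j%:R + x); last first.
  exfalso; apply: nz; apply: L0_eigenspace_eq0 (intertwining_weight x intI ui vj) _ => k.
  by rewrite (inj_eq (addrI _)); apply/eqP => kE; apply: nk; exists k.
exists (k%:Z - (i + j)%N%:Z); first by lia.
by rewrite rmorphB /= -[X in X - _]/(k%:R) kE -[X in _ - X]/((i + j)%N%:R) natrD; ring.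
Qed.

Lemma intertwining_zgraded : intertwining_op W1 W2 W3 I ->
  zgraded_intertwining_op (L0_graded dW1) (L0_graded dW2) (L0_graded dW3)
    (fun u v => xpow_mul c (I u v)).
Proof.
move=> intI; have [_ _ J D] := intI; split.
- exact: bilinear_xpow_mul.
- by move=> u v; exact: intertwining_laurent.
- move=> i j k u v ui vj; apply/extend_grading_L0.
  have := intertwining_weight (- k%:~R - 1) intI ui vj.
  rewrite (_ : i%:R + j%:R + _ = (i%:Z + j%:Z - k - 1)%:~R) //.
  by rewrite !rmorphB rmorphD /=; ring.
- have := @jacobi_rational K V W1 W2 W3 _ _ _ (@modY_laurent _ _ W1) (@modY_laurent _ _ W2)
    (@modY_laurent _ _ W3) (modY_bilinear W3) I c IB
    (fun u v => intertwining_laurent u v intI).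
  by move=> [+ _]; exact.
Qed.

Lemma intertwining_of_zgraded :
  zgraded_intertwining_op (L0_graded dW1) (L0_graded dW2) (L0_graded dW3)
    (fun u v => xpow_mul c (I u v)) ->
  intertwining_op W1 W2 W3 I.
Proof.
move=> [_ IL Igr rat].
have J : jacobi_identity (modY W1) (modY W2) (modY W3) I.
  have [_] := @jacobi_rational K V W1 W2 W3 _ _ _ (@modY_laurent _ _ W1)
    (@modY_laurent _ _ W2) (@modY_laurent _ _ W3) (modY_bilinear W3) I c IB IL.
  exact.
split=> //.
  move=> u v alpha; have [N IN] := IL u v.
  (* If this exponent of x^c I is not an integer, all coefficients u_(alpha+m) v vanish. If it is z,
     they are the coefficients at z - m, which fall below the pole bound N as soon as m > z - N. *)
  have [[z zE]|nz] := pselect (is_int (- alpha - 1 + c)); last first.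
    exists 0%N => m _; apply: (I_shift_int (c := c)) => // -[z zE]; apply: nz.
    exists (z + m%:Z); rewrite rmorphD /= -zE; ring.
  exists (absz (z - N)).+1 => m zm; apply: contrapT => Inz.
  have : xpow_mul c (I u v) (z - m%:Z)%:~R <> 0.
    rewrite /xpow_mul rmorphB /= -zE => Iz; apply: Inz; rewrite -Iz.
    congr (I u v _); ring.
  by move=> /IN [n Nn /intr_inj]; lia.
(* The property is additive in u and in v, which reduces it to homogeneous vectors. *)
pose D u v := I (Lmode (modY W1) (omega V) (-1) u) v = derivative (I u v).
have LD u u' : Lmode (modY W1) (omega V) (-1) (u + u')
    = Lmode (modY W1) (omega V) (-1) u + Lmode (modY W1) (omega V) (-1) u'.
  rewrite /Lmode /mode; have := (modY_bilinear W1).1 (omega V) 1 u u'.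
  by rewrite !scale1r => ->.
have L0 : Lmode (modY W1) (omega V) (-1) 0 = 0.
  by rewrite /Lmode /mode (bilinear_0r _ (modY_bilinear W1)).
have IDl u u' v : I (u + u') v = I u v + I u' v.
  by have := IB.2 v 1 u u'; rewrite /= !scale1r.
have IDr u v v' : I u (v + v') = I u v + I u v'.
  by have := IB.1 u 1 v v'; rewrite /= !scale1r.
have derivD (f g : K -> W3) : derivative (f + g) = derivative f + derivative g.
  by apply/funext => x; exact: scalerDr.
have deriv0 : derivative (0 : K -> W3) = 0.
  by apply/funext => x; exact: scaler0.
suff : forall u v, D u v by [].
move=> u v; move: u; apply: (direct_sum_ind dW1).
- by rewrite /D L0 !(bilinear_0l _ IB) deriv0.
- by rewrite /D => u u' Du Du'; rewrite LD !IDl derivD Du Du'.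
move=> i u ui; move: v; apply: (direct_sum_ind dW2).
- by rewrite /D !(bilinear_0r _ IB) deriv0.
- by rewrite /D => v v' Dv Dv'; rewrite !IDr derivD Dv Dv'.
move=> j v vj; apply/funext => x.
apply: (derivative_of_weights IB J ui vj).
(* At a non-integral exponent of x^c I the coefficient is 0, which lies in every eigenspace. *)
have [[k kE]|nk] := pselect (is_int (x + 1 + c)); last first.
  rewrite (I_shift_int IL u v nk).
  rewrite /L0_eigenspace /eigenspace_of /= scaler0 /Lmode /mode.
  by rewrite (bilinear_0r _ (modY_bilinear W3)).
(* The mode of index -k-1 is the coefficient of x^k. *)
have := Igr i j (- k - 1) u v ui vj => /extend_grading_L0.
rewrite /xpow_mul.
have -> : - (- k - 1)%:~R - 1 - c = x + 1 :> K.
  rewrite rmorphB rmorphN /= -kE; ring.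
rewrite (_ : lambda3 + _ = lambda1 + i%:R + (lambda2 + j%:R) + (x + 1)) //.
rewrite !rmorphB rmorphD rmorphN /= -kE /c; ring.
Qed.

End GradedIntertwiningOperators.

(** * The linear isomorphism *)

Lemma intertwining_op_bilinear (K : numFieldType) (V : voa K) (W1 W2 W3 : voa_module V)
    (I : W1 -> W2 -> K -> W3) :
  intertwining_op W1 W2 W3 I -> bilinear_map I.
Proof. by case. Qed.

(** The gradings make x^c I a Laurent series. The Jacobi identity can then be checked on
    coefficients given by finite sums, where it is preserved by linear combinations. *)
Lemma intertwining_subspace (K : numFieldType) (V : voa K) (W1 W2 W3 : voa_module V)
    (lambda1 lambda2 lambda3 : K)
    (dW1 : direct_sum (fun j : nat => L0_eigenspace W1 (lambda1 + j%:R)))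
    (dW2 : direct_sum (fun j : nat => L0_eigenspace W2 (lambda2 + j%:R)))
    (dW3 : direct_sum (fun j : nat => L0_eigenspace W3 (lambda3 + j%:R))) :
  subspace (intertwining_op W1 W2 W3).
Proof.
set c := lambda1 + lambda2 - lambda3.
have jacP := @jacobi_borcherds K V W1 W2 W3 _ _ _ (@modY_laurent _ _ W1)
  (@modY_laurent _ _ W2) (@modY_laurent _ _ W3) (modY_bilinear W3).
split.
  have B0 : bilinear_map (0 : W1 -> W2 -> K -> W3).
    by split=> u k v v'; rewrite scaler0 addr0.
  split=> //.
  - by move=> *; exists 0%N.
  - move=> a u v e; rewrite /series_mul.
    rewrite !fsbig1 ?subrr // => -[[d0 d1] d2] _; case: e => -[e0 e1] e2 /=;
      case: ifP => _; rewrite ?scaler0 //.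
    by rewrite (bilinear_0r _ (modY_bilinear W3)) scaler0.
  - by move=> u v; apply/funext => x; rewrite /derivative scaler0.
move=> k I I' intI intI'.
have [IB It J D] := intI; have [IB' It' J' D'] := intI'.
have IL u v := @intertwining_laurent _ _ _ _ _ _ _ _ dW1 dW2 dW3 I IB u v intI.
have IL' u v := @intertwining_laurent _ _ _ _ _ _ _ _ dW1 dW2 dW3 I' IB' u v intI'.
have kB : bilinear_map (k *: I + I').
  split=> [u d v v'|v d u u'].
    rewrite -[LHS]/(k *: I u (d *: v + v') + I' u (d *: v + v')) IB.1 IB'.1.
    rewrite -[(_ + _) u v]/(k *: I u v + I' u v) -[(_ + _) u v']/(k *: I u v' + I' u v').
    by rewrite !scalerDr !scalerA mulrC addrACA.
  rewrite -[LHS]/(k *: I (d *: u + u') v + I' (d *: u + u') v).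
  rewrite [I (_ + _) v](IB.2 v) [I' (_ + _) v](IB'.2 v).
  rewrite -[(_ + _) u v]/(k *: I u v + I' u v) -[(_ + _) u' v]/(k *: I u' v + I' u' v).
  by rewrite !scalerDr !scalerA mulrC addrACA.
split=> //.
- move=> u v alpha; have [N IN] := It u v alpha; have [N' IN'] := It' u v alpha.
  exists (maxn N N') => m; rewrite geq_max => /andP[/IN Im /IN' Im'].
  by rewrite -[LHS]/(k *: I u v _ + I' u v _) Im Im' scaler0 addr0.
- have kL u v : laurent (xpow_mul c ((k *: I + I') u v)).
    exact: laurent_linear (IL u v) (IL' u v).
  apply/(jacP _ c kB kL) => a u v n m b.
  have /jacP {}J := J; have /jacP {}J' := J'.
  have := borcherds_linear k
    (bounded_coef_IY (@modY_laurent _ _ W2) c IB a u v)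
    (bounded_coef_YI (modY_bilinear W3) IL a u v)
    (bounded_coef_IYu (@modY_laurent _ _ W1) c IB a u v)
    (bounded_coef_IY (@modY_laurent _ _ W2) c IB' a u v)
    (bounded_coef_YI (modY_bilinear W3) IL' a u v)
    (bounded_coef_IYu (@modY_laurent _ _ W1) c IB' a u v)
    (J c IB IL a u v n m b) (J' c IB' IL' a u v n m b).
  (* Only the series Y(a, y) I(u, x) v needs an argument, the linearity of the vertex operator on
     [W3]. *)
  congr (borcherds _ _ _ n m b); apply/funext => p; apply/funext => q.
  have := (modY_bilinear W3).1 a k (I u v (p%:~R - c)) (I' u v (p%:~R - c)).
  by move=> /(congr1 (@^~ q%:~R)) /esym.
- move=> u v; rewrite -[LHS]/(k *: I _ v + I' _ v) D D'.
  by apply/funext => x; rewrite /derivative -[RHS]/((x + 1) *: (k *: I u v _ + I' u v _))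
    scalerDr -[LHS]/(k *: ((x + 1) *: I u v _) + (x + 1) *: I' u v _) !scalerA mulrC.
Qed.

Theorem proposition3p3 (R : realType) (V : voa R[i])
    (W1 W2 W3 : voa_module V) (lambda1 lambda2 lambda3 : R[i])
    (dW1 : direct_sum (fun j : nat => L0_eigenspace W1 (lambda1 + j%:R)))
    (dW2 : direct_sum (fun j : nat => L0_eigenspace W2 (lambda2 + j%:R)))
    (dW3 : direct_sum (fun j : nat => L0_eigenspace W3 (lambda3 + j%:R))) :
  linear_isomorphism
    (intertwining_op W1 W2 W3)
    (zgraded_intertwining_op (L0_graded dW1) (L0_graded dW2) (L0_graded dW3))
    (fun (I : W1 -> W2 -> R[i] -> W3) (u : W1) (v : W2) =>
       xpow_mul (lambda1 + lambda2 - lambda3) (I u v)).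
Proof.
set c := lambda1 + lambda2 - lambda3.
have bij : set_bij (intertwining_op W1 W2 W3)
    (zgraded_intertwining_op (L0_graded dW1) (L0_graded dW2) (L0_graded dW3))
    (fun (I : W1 -> W2 -> R[i] -> W3) u v => xpow_mul c (I u v)).
  split=> [I intI|I I' _ _ II'|Phi gPhi].
  - by apply: intertwining_zgraded; first exact: intertwining_op_bilinear.
  - apply/funext => u; apply/funext => v.
    by rewrite -(xpow_mulNK c (I u v)) -(xpow_mulNK c (I' u v)) (congr1 (fun F => F u v) II').
  - have Phi_c : (fun u v => xpow_mul c (xpow_mul (- c) (Phi u v))) = Phi.
      by apply/funext => u; apply/funext => v; rewrite xpow_mulK.
    (* The preimage is x^(-c) Phi. *)
    exists (fun u v => xpow_mul (- c) (Phi u v)); last exact: Phi_c.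
    apply: (intertwining_of_zgraded (dW1 := dW1) (dW2 := dW2) (dW3 := dW3)).
      by apply: bilinear_xpow_mul; have [] := gPhi.
    by rewrite -/c Phi_c.
have sA := intertwining_subspace dW1 dW2 dW3.
by split=> //; apply: subspace_image bij.
Qed.
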